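(* Let $0<p<1$. (a) There exists a constant $c_p$, depending only on $p$, such that for every $F\in H_p(G)$ and every $n\in\mathbb{N}_+$ $$\|S_nF\|_{H_p}\le c_p\,2^{d(n)(1/p-1)}\,\|F\|_{H_p}.$$ (b) Let $\{m_k:k\ge 0\}$ be any increasing sequence of positive integers such that $\sup_{k\in\mathbb{N}} d(m_k)=\infty$, and let $\Phi:\mathbb{N}_+\to[1,\infty)$ be any nondecreasing function satisfying $$\limsup_{k\to\infty}\frac{2^{d(m_k)(1/p-1)}}{\Phi(m_k)}=\infty .$$ Then there exists a martingale $F\in H_p(G)$ such that $$\sup_{k\in\mathbb{N}}\left\|\frac{S_{m_k}F}{\Phi(m_k)}\right\|_{L_{p,\infty}}=\infty .$$
   Context: $\mathbb{N}_+$ is the set of positive integers and $\mathbb{N}=\mathbb{N}_+\cup\{0\}$. $G=\prod_{k=0}^\infty Z_2$ is the dyadic (Walsh) group, i.e. the set of sequences $x=(x_0,x_1,\dots)$, $x_k\in\{0,1\}$, with coordinatewise addition mod 2, product topology, and normalized Haar measure $\mu$ (the product of the measures giving mass $1/2$ to each point of $Z_2$). Put $I_0(x)=G$, $I_n(x)=\{y\in G: y_0=x_0,\dots,y_{n-1}=x_{n-1}\}$, and let $\zeta_n$ be the $\sigma$-algebra generated by $\{I_n(x):x\in G\}$. For $n\in\mathbb{N}_+$ with binary expansion $n=\sum_{j\ge0}n_j2^j$, $n_j\in\{0,1\}$, put $\langle n\rangle=\min\{j:n_j\ne0\}$, $|n|=\max\{j:n_j\neq0\}$, $d(n)=|n|-\langle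 n\rangle$. Rademacher functions: $r_k(x)=(-1)^{x_k}$. Walsh functions: $w_n(x)=\prod_{k\ge0}r_k(x)^{n_k}$, $n\in\mathbb{N}$. A martingale $F=(F_n,n\in\mathbb{N})$ is a martingale with respect to $(\zeta_n)_{n\in\mathbb N}$. Its maximal function is $F^*=\sup_n|F_n|$; for $0<p<\infty$, $H_p(G)$ is the space of martingales with $\|F\|_{H_p}:=\|F^*\|_p<\infty$, where $\|f\|_p^p=\int_G|f|^p\,d\mu$. The weak quasi-norm is $\|f\|_{L_{p,\infty}}^p=\sup_{\lambda>0}\lambda^p\mu(|f|>\lambda)$. Walsh–Fourier coefficients of a martingale: $\widehat F(k)=\lim_{n\to\infty}\int_GF_nw_k\,d\mu$ (the limit always exists). Partial sums: $S_nF=\sum_{k=0}^{n-1}\widehat F(k)w_k$; in particular $S_{2^n}F=F_n$. An integrable function $f$ (such as $S_nF$) is identified with the martingale $(E(f\mid\zeta_n))_{n}$ of its conditional expectations when its $H_p$ quasi-norm is taken. *)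

(* Defs.v *)
From HB Require Import structures.
From mathcomp Require Import all_boot all_order all_algebra.
From mathcomp Require Import all_classical all_reals all_analysis.
From mathcomp Require Import measurable_realfun.
From mathcomp Require Import zify ring lra.
Set Implicit Arguments.
Unset Strict Implicit.
Unset Printing Implicit Defensive.
Import Order.TTheory GRing.Theory Num.Theory.
Import numFieldNormedType.Exports.
Local Open Scope classical_set_scope.
Local Open Scope ring_scope.

(* Sequences in {0,1}, encoded as nat -> bool, with the Borel sigma-algebra of
   the product topology. *)
Notation dyadic_group := (g_sigma_algebraType (@open cantor_space)).

Definition dyadic_add (x y : dyadic_group) : dyadic_group :=
  fun k => x k (+) y k.

(* Such a mu exists (normalized_haar_exists) and is unique
   (normalized_haar_unique); by normalized_haarP it is the product of the
   measures of mass 1/2 on each point of {0,1}. *)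
Definition normalized_haar (R : realType) (mu : probability dyadic_group R) :=
  forall (a : dyadic_group) (A : set dyadic_group), measurable A ->
    mu (dyadic_add a @` A) = mu A.

Definition dyadic_interval (n : nat) (x : dyadic_group) : set dyadic_group :=
  [set y | forall k, (k < n)%N -> y k = x k].

Definition zeta (n : nat) : set (set dyadic_group) :=
  <<s range (dyadic_interval n) >>.

(* The binary digit n_j. Since n < 2 ^ n, n_j = 0 for j >= n, so j < n suffices
   in low_bit, high_bit and walsh. *)
Definition bit (n j : nat) : bool := odd (n %/ 2 ^ j).

(* <n>, |n| and d(n); meaningful for n > 0 only *)
Definition low_bit (n : nat) : nat := find (bit n) (iota 0 n).

Definition high_bit (n : nat) : nat := (\max_(j < n | bit n j) j)%N.

Definition bit_width (n : nat) : nat := (high_bit n - low_bit n)%N.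

Definition rademacher (R : realType) (k : nat) (x : dyadic_group) : R :=
  (-1) ^+ x k.

Definition walsh (R : realType) (n : nat) (x : dyadic_group) : R :=
  \prod_(k < n) rademacher R k x ^+ bit n k.

(* g is (a version of) E(f | zeta n) *)
Definition is_cond_exp (R : realType) (mu : probability dyadic_group R)
    (n : nat) (f g : dyadic_group -> R) : Prop :=
  [/\ forall B : set R, measurable B -> zeta n (g @^-1` B),
      mu.-integrable [set: dyadic_group] (EFin \o g) &
      forall A, zeta n A ->
        (\int[mu]_(x in A) (g x)%:E = \int[mu]_(x in A) (f x)%:E)%E].

(* is_cond_exp contains adaptedness and integrability of F n *)
Definition martingale (R : realType) (mu : probability dyadic_group R)
    (F : nat -> dyadic_group -> R) : Prop :=
  forall n, is_cond_exp mu n (F n.+1) (F n).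

(* The atoms of zeta n are the dyadic intervals of rank n, which have positive
   Haar measure; is_cond_expP shows that this average is the unique version of
   E(f | zeta n). *)
Definition cond_exp (R : realType) (mu : probability dyadic_group R)
    (n : nat) (f : dyadic_group -> R) : dyadic_group -> R :=
  fun x => (\int[mu]_(y in dyadic_interval n x) f y)
           / fine (mu (dyadic_interval n x)).

Definition maximal_function (R : realType) (F : nat -> dyadic_group -> R)
    (x : dyadic_group) : \bar R :=
  ereal_sup (range (fun n => `|F n x|%:E)).

(* For 0 < p < 1, Lnorm is still (\int |f| ^ p) ^ (1 / p), here a quasi-norm. *)
Definition hardy_norm (R : realType) (mu : probability dyadic_group R) (p : R)
    (F : nat -> dyadic_group -> R) : \bar R :=
  'N[mu]_(p%:E)[maximal_function F].

Definition hardy_space (R : realType) (mu : probability dyadic_group R) (p : R)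
    (F : nat -> dyadic_group -> R) : Prop :=
  martingale mu F /\ (hardy_norm mu p F < +oo)%E.

Definition weak_Lp_norm (R : realType) (mu : probability dyadic_group R) (p : R)
    (f : dyadic_group -> R) : \bar R :=
  ((ereal_sup [set (lam `^ p)%:E * mu [set x | (lam < `|f x|)%R]
               | lam in [set lam : R | (0 < lam)%R]]) `^ p^-1)%E.

Definition walsh_coef (R : realType) (mu : probability dyadic_group R)
    (F : nat -> dyadic_group -> R) (k : nat) : R :=
  limn (fun n => \int[mu]_x (F n x * walsh R k x)).

Definition partial_sum (R : realType) (mu : probability dyadic_group R)
    (n : nat) (F : nat -> dyadic_group -> R) : dyadic_group -> R :=
  fun x => \sum_(k < n) walsh_coef mu F k * walsh R k x.

Lemma open_dyadic_interval n (x : dyadic_group) :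
  @open cantor_space (dyadic_interval n x).
Proof.
elim: n => [|n IH].
  have -> : dyadic_interval 0 x = setT by apply/seteqP; split.
  exact: openT.
have -> : dyadic_interval n.+1 x =
    dyadic_interval n x `&` ((fun y : cantor_space => y n) @^-1` [set x n]).
  apply/seteqP; split => y /= => [h|[h1 h2] k].
    by split=> [k kn|]; apply: h => //; exact: ltnW.
  by rewrite ltnS leq_eqVlt => /orP[/eqP->|/h1].
apply: openI => //; apply: open_comp; last exact: discrete_open.
by move=> z _; exact: (@proj_continuous nat (fun=> bool) n).
Qed.

Lemma measurable_dyadic_interval n (x : dyadic_group) :
  measurable (dyadic_interval n x).
Proof. by apply: sub_sigma_algebra; exact: open_dyadic_interval. Qed.

Lemma open_dyadicP (A : set dyadic_group) (x : dyadic_group) :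
  @open cantor_space A -> A x -> exists n, dyadic_interval n x `<=` A.
Proof.
move=> oA Ax; apply: contrapT => /forallNP hn.
have {}hn n : exists y : cantor_space, dyadic_interval n x y /\ ~ A y.
  have /existsNP[y /not_implyP[? ?]] := hn n; by exists y.
have [y yP] := choice hn.
have cy : y @ \oo --> (x : cantor_space).
  apply/(@cvg_sup _ _ _ (y @ \oo)).
  move=> k.
  apply/cvg_image; first by rewrite eqEsubset; split => // b _; exists (fun=> b).
  move=> B /nbhs_singleton Bxk /=; exists [set z : cantor_space | B (z k)].
    exists k.+1 => // n /= kn.
    by have [h _] := yP n; rewrite /= h.
  rewrite eqEsubset; split => [_ [z Bz <-]//|b Bb]; by exists (fun=> b).
have [N _ hN] : (y @ \oo) A by apply: cy; exact: open_nbhs_nbhs.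
by have [_] := yP N; apply; exact: (hN N (leqnn N)).
Qed.

(* cyl indexes the dyadic intervals by a countable type. *)
Definition cyl (s : seq bool) : set dyadic_group :=
  dyadic_interval (size s) (nth false s).

Lemma dyadic_interval_cyl n x : dyadic_interval n x = cyl (mkseq x n).
Proof.
rewrite /cyl size_mkseq; apply/seteqP; split => y h k kn; rewrite h//.
  by rewrite nth_mkseq.
by rewrite nth_mkseq.
Qed.

Lemma dyadic_intervalxx n x : dyadic_interval n x x.
Proof. by []. Qed.

Lemma open_cyl (A : set dyadic_group) : @open cantor_space A ->
  A = \bigcup_(s : seq bool) (if `[< cyl s `<=` A >] then cyl s else set0).
Proof.
move=> oA; apply/seteqP; split => [x Ax|x [s _]].
  have [n hn] := open_dyadicP oA Ax.
  exists (mkseq x n) => //; rewrite -dyadic_interval_cyl.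
  by case: asboolP => // _; exact: dyadic_intervalxx.
by case: asboolP => // h /h.
Qed.

Lemma measurable_dyadicE :
  (@measurable _ dyadic_group) =
  <<s [set A | A = set0 \/ exists n x, A = dyadic_interval n x] >>.
Proof.
apply/seteqP; split; apply: smallest_sub.
- exact: smallest_sigma_algebra.
- move=> A oA; rewrite (open_cyl oA).
  apply: (@countable_bigcupT_measurable _ 
    (g_sigma_algebraType [set A : set cantor_space |
       A = set0 \/ exists n x, A = dyadic_interval n x])).
    exact: countableP.
  move=> s; apply: sub_sigma_algebra => /=; case: ifPn => _; last by left.
  by right; exists (size s), (nth false s).
- exact: sigma_algebra_measurable.
- move=> A [->|[n [x ->]]]; [exact: measurable0|].
  exact: measurable_dyadic_interval.
Qed.

Lemma dyadic_measure_unique (R : realType)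
    (m1 m2 : probability dyadic_group R) :
  (forall n x, m1 (dyadic_interval n x) = m2 (dyadic_interval n x)) ->
  forall A, measurable A -> m1 A = m2 A.
Proof.
move=> h; rewrite measurable_dyadicE.
apply: (@g_sigma_algebra_measure_unique _ _ _ _ _ (fun=> setT)).
- move=> A [->|[n [x ->]]]; [exact: measurable0|].
  exact: measurable_dyadic_interval.
- move=> _; right; exists 0%N, (fun=> false).
  by apply/seteqP; split.
- by apply/seteqP; split => // x _; exists 0%N.
- move=> A B [->|[n [x ->]]]; first by rewrite set0I; left.
  move=> [->|[m [y ->]]]; first by rewrite setI0; left.
  have [[z [zx zy]]|e] := pselect (exists z,
      dyadic_interval n x z /\ dyadic_interval m y z).
    right; exists (maxn n m), z; apply/seteqP; split => t /=.
      by move=> [tx ty] k; rewrite leq_max => /orP[kn|km]; 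
        [rewrite (tx k)// (zx k)|rewrite (ty k)// (zy k)].
    move=> tz; split => k kn; rewrite (tz k) ?leq_max ?kn ?orbT//; [exact: zx|exact: zy].
  by left; apply/seteqP; split => z //= [? ?]; apply: e; exists z.
- by move=> A [->|[n [x ->]]]; [rewrite !measure0|exact: h].
- by move=> _; rewrite (le_lt_trans (probability_le1 _ _)) ?ltry//.
Qed.

Lemma dyadic_addK a : involutive (dyadic_add a).
Proof. by move=> x; apply/funext => k; rewrite /dyadic_add addbA addbb. Qed.

Lemma image_dyadic_add a (A : set dyadic_group) :
  dyadic_add a @` A = dyadic_add a @^-1` A.
Proof.
apply/seteqP; split => [_ [y Ay <-]|x Ax] /=; first by rewrite dyadic_addK.
by exists (dyadic_add a x) => //; rewrite dyadic_addK.
Qed.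

Lemma preimage_dyadic_add a n x :
  dyadic_add a @^-1` dyadic_interval n x = dyadic_interval n (dyadic_add a x).
Proof.
apply/seteqP; split => y h k kn; have := h k kn; rewrite /dyadic_add.
  by move=> <-; rewrite addbA addbb.
by move=> ->; rewrite addbA addbb.
Qed.

Lemma measurable_dyadic_fun d (T : measurableType d) (f : T -> dyadic_group) :
  (forall n x, measurable (f @^-1` dyadic_interval n x)) ->
  measurable_fun setT f.
Proof.
move=> h; apply: (@measurability _ _ T dyadic_group setT f _ measurable_dyadicE).
move=> _ [_ [->|[n [x ->]]] <-]; first by rewrite preimage_set0 setI0.
by rewrite setTI.
Qed.

Lemma dyadic_intervalS n (x : dyadic_group) :
  dyadic_interval n x = dyadic_interval n.+1 (fun k => if (k == n)%N then false else x k)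
  `|` dyadic_interval n.+1 (fun k => if (k == n)%N then true else x k).
Proof.
apply/seteqP; split => y /=.
  move=> h; case E : (y n); [right|left] => k;
  by rewrite ltnS leq_eqVlt; case: eqP => [->|] //= _; exact: h.
by move=> [] h k kn; rewrite (h k (ltnW _))// (ltn_eqF kn).
Qed.

Lemma normalized_haarP (R : realType) (mu : probability dyadic_group R) :
  normalized_haar mu <->
  forall n x, mu (dyadic_interval n x) = (2 ^- n)%:E.
Proof.
split=> [H|H].
  have Hxy n x y : mu (dyadic_interval n x) = mu (dyadic_interval n y).
    rewrite -(H (dyadic_add x y)); last exact: measurable_dyadic_interval.
    rewrite image_dyadic_add preimage_dyadic_add; congr (mu (dyadic_interval n _)).
    by apply/funext => k; rewrite /dyadic_add addbAC addbb.
  elim=> [|n IH] x.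
    rewrite expr0 invr1 -(probability_setT mu); congr (mu _).
    by apply/seteqP; split.
  have := IH x; rewrite dyadic_intervalS measureU; last 3 first.
  - exact: measurable_dyadic_interval.
  - exact: measurable_dyadic_interval.
  - rewrite -subset0 => y [/(_ n (leqnn _)) + /(_ n (leqnn _))].
    by rewrite eqxx => -> .
  rewrite [X in (X + _)%E](Hxy _ _ x) [X in (_ + X)%E](Hxy _ _ x).
  have : mu (dyadic_interval n.+1 x) \is a fin_num.
    by apply: fin_num_measure; exact: measurable_dyadic_interval.
  move=> /fineK <-; rewrite -EFinD => -[h]; congr EFin.
  rewrite exprS invfM -h; lra.
move=> a A mA; rewrite image_dyadic_add.
have mf : measurable_fun setT (dyadic_add a).
  apply: measurable_dyadic_fun => n x; rewrite preimage_dyadic_add.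
  exact: measurable_dyadic_interval.
pose f := (HB.pack (dyadic_add a) (isMeasurableFun.Build _ _ _ _ _ mf) : {mfun _ >-> _}).
apply: (@dyadic_measure_unique R (distribution mu f) mu) => // n x.
transitivity (mu (dyadic_add a @^-1` dyadic_interval n x)); first by [].
by rewrite preimage_dyadic_add !H.
Qed.

Lemma normalized_haar_unique (R : realType)
    (m1 m2 : probability dyadic_group R) :
  normalized_haar m1 -> normalized_haar m2 ->
  forall A, measurable A -> m1 A = m2 A.
Proof.
move=> /normalized_haarP h1 /normalized_haarP h2.
by apply: dyadic_measure_unique => n x; rewrite h1 h2.
Qed.

(* Haar measure is realized as the image of Lebesgue measure on [0, 1] under
   binary expansion. *)
Definition digit (R : realType) (k : nat) (x : measurableTypeR R) : bool :=
  odd (Num.truncn (2 ^+ k.+1 * (x : R))).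
Arguments digit {R} k x.

Definition digits (R : realType) (x : measurableTypeR R) : dyadic_group :=
  digit ^~ x.
Arguments digits {R} x.


Lemma digits_intervalP (R : realType) n (y : dyadic_group) (x : R) :
  0 <= x < 1 -> dyadic_interval n y (digits x) <->
  Num.truncn (2 ^+ n * x) = iteri n (fun k v => v.*2 + y k)%N 0%N.
Proof.
move=> /andP[x0 x1].
have T0 k : 0 <= 2 ^+ k * x by rewrite mulr_ge0// exprn_ge0.
have TS k : Num.truncn (2 ^+ k.+1 * x) =
    ((Num.truncn (2 ^+ k * x)).*2 + digits x k)%N.
  rewrite -[LHS]odd_double_half addnC; congr (_.*2 + _)%N.
  apply/eqP; rewrite eq_sym truncn_eq//.
  have /andP[] := truncn_itv (T0 k.+1); rewrite exprS -mulrA.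
  set t := Num.truncn _; set z := 2 ^+ k * x => h1 h2.
  have := odd_double_half t => e.
  have e1 : (t%:R = (odd t)%:R + 2 * (t./2)%:R :> R) by rewrite -{1}e natrD -muln2 natrM mulrC.
  rewrite -[t.+1]addn1 natrD e1 in h2; rewrite e1 in h1.
  rewrite -[(t./2).+1]addn1 natrD.
  by move: h1 h2; case: (odd t) => /= h1 h2; apply/andP; split; lra.
elim: n => [|n IH] /=.
  by split=> // _; apply/eqP; rewrite truncn_eq//= expr0 mul1r x0 x1.
rewrite TS; split => [h|h].
  rewrite (h n)//; congr (_.*2 + _)%N; apply/IH => k kn; apply: h; exact: ltnW.
have e : digits x n = y n by move/(congr1 odd): h; rewrite !oddD !odd_double /= !oddb.
have {}h : dyadic_interval n y (digits x).
  by apply/IH; move: h; rewrite e => /addIn/double_inj.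
by move=> k; rewrite ltnS leq_eqVlt => /orP[/eqP->|/h].
Qed.

Lemma normalized_haar_exists (R : realType) :
  exists mu : probability dyadic_group R, normalized_haar mu.
Proof.
have mdig k b : measurable [set x : measurableTypeR R | digit k x = b].
  have -> : [set x : R | digit k x = b] =
    \bigcup_(j in [set j | odd j = b]) [set x : R | Num.truncn (2 ^+ k.+1 * x) = j].
    by apply/seteqP; split => [x <-|x [j /= <- <-]//]; exists (Num.truncn (2 ^+ k.+1 * x)).
  apply: bigcup_measurable => j _; apply: is_interval_measurable.
  move=> x y /= hx hy z /andP[xz zy]; apply/eqP; rewrite eqn_leq -{1}hy -hx.
  by rewrite !le_truncn// ler_pM2l// exprn_gt0.
have mf : measurable_fun [set: measurableTypeR R] (@digits R).
  apply: measurable_dyadic_fun; elim=> [|n IH] x.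
    by rewrite (_ : _ @^-1` _ = setT)//; apply/seteqP; split.
  rewrite (_ : _ @^-1` _ = digits @^-1` dyadic_interval n x `&` [set z | digit n z = x n]).
    exact: measurableI.
  apply/seteqP; split => y /= => [h|[h1 h2] k].
    by split=> [k kn|]; apply: h => //; exact: ltnW.
  by rewrite ltnS leq_eqVlt => /orP[/eqP->|/h1].
pose f := (HB.pack (@digits R) (isMeasurableFun.Build _ _ _ _ _ mf) : {mfun _ >-> _}).
exists (distribution (uniform_prob (@ltr01 R)) f).
apply/normalized_haarP => n x.
rewrite /distribution /pushforward /=.
set v := iteri n (fun k v => v.*2 + x k)%N 0%N.
have vn : (v < 2 ^ n)%N.
  rewrite /v; elim: (n) => //= m IH; rewrite expnS; case: (x m); lia.
have p0 : (0 < 2 ^+ n :> R) by rewrite exprn_gt0.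
have vn' : (v.+1%:R <= 2 ^+ n :> R) by rewrite -natrX ler_nat.
have mD : measurable
    (@digits R @^-1` dyadic_interval n x : set (measurableTypeR R)).
  have := mf measurableT _ (measurable_dyadic_interval n x).
  by rewrite setTI.
transitivity (uniform_prob (@ltr01 R) (@digits R @^-1` dyadic_interval n x)); first by [].
rewrite /uniform_prob integral_uniform_pdf.
transitivity (\int[lebesgue_measure]_(t in @digits R @^-1` dyadic_interval n x `&` `[0%R, 1%R])
  (cst 1 t))%E.
  apply: eq_integral => t; rewrite inE => -[_] /=; rewrite in_itv /= /uniform_pdf => ->.
  by rewrite subr0 invr1.
rewrite integral_cst ?mul1e; last exact: measurableI.
have -> : @digits R @^-1` dyadic_interval n x `&` `[0, 1] =
    `[v%:R / 2 ^+ n, v.+1%:R / 2 ^+ n[ `|` (@digits R @^-1` dyadic_interval n x `&` [set 1]).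
  have key t : 0 <= t < 1 -> @digits R t \in dyadic_interval n x <->
     v%:R / 2 ^+ n <= t < v.+1%:R / 2 ^+ n.
    move=> t01; rewrite inE; apply: (iff_trans (digits_intervalP _ _ t01)).
    rewrite ler_pdivrMr// ltr_pdivlMr// mulrC -truncn_eq.
      by split=> /eqP.
    by rewrite mulr_ge0 ?exprn_ge0//; case/andP: t01.
  apply/seteqP; split => t /=; rewrite !in_itv /=.
    move=> [Dt /andP[t0]]; rewrite le_eqVlt => /orP[/eqP t1|t1]; first by right.
    left; have t01 : 0 <= t < 1. by rewrite t0 t1.
 have [+ _] := key _ t01.
    by apply; rewrite inE.
  move=> [h|[Dt t1]]; last by split=> //; rewrite t1 ler01 lexx.
  have t01 : 0 <= t < 1.
    case/andP: h => h1 h2; rewrite (le_trans _ h1) ?divr_ge0// ?(ltW p0)//.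
    by rewrite (lt_le_trans h2)// ler_pdivrMr// mul1r.
  split; last by case/andP: t01 => -> /ltW ->.
  by have [_ /(_ h)] := key _ t01; rewrite inE.
rewrite measureU0//=; last 2 first.
- by apply: measurableI => //; exact: measurable_set1.
- have s1 : @digits R @^-1` dyadic_interval n x `&` [set 1] `<=` [set 1] by move=> ? [].
  apply/eqP; rewrite eq_le measure_ge0 andbT -(lebesgue_measure_set1 (1 : R)).
  apply: le_measure => //; rewrite inE; last exact: measurable_set1.
  by apply: measurableI => //; exact: measurable_set1.
rewrite lebesgue_measure_itv /= lte_fin ltr_pM2r ?invr_gt0// ltr_nat ltnSn.
by rewrite -EFinB -mulrBl -natrB// subSnn mul1r.
Qed.


Lemma zetaP n (A : set dyadic_group) :
  zeta n A <-> forall x, A x -> dyadic_interval n x `<=` A.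
Proof.
split=> [|h].
  have : zeta n `<=` [set B | forall x y, dyadic_interval n x y -> (B x <-> B y)].
    apply: smallest_sub; first split => /=.
    - by [].
    - by move=> B hB x y /hB e; split=> -[_ h]; split=> // /e.
    - move=> B hB x y xy.
      by split=> -[k _ Bk]; exists k => //; apply/(hB k _ _ xy).
    move=> _ [z _ <-] x y xy; split=> h k kn.
      by rewrite xy// h.
    by rewrite -xy// h.
  by move=> + zA x Ax y xy => /(_ _ zA)/(_ _ _ xy) <-.
have -> : A = \bigcup_(s : seq bool)
    (if `[< dyadic_interval n (nth false s) `<=` A >]
     then dyadic_interval n (nth false s) else set0).
  apply/seteqP; split => [x Ax|x [s _]]; last by case: asboolP => // h' /h'.
  have e : dyadic_interval n (nth false (mkseq x n)) = dyadic_interval n x.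
    by apply/seteqP; split => y xy k kn; rewrite xy// nth_mkseq.
  by exists (mkseq x n) => //; rewrite e; case: asboolP => // -[]; exact: h.
apply: (@countable_bigcupT_measurable _
  (g_sigma_algebraType (range (dyadic_interval n)))).
  exact: countableP.
move=> s; case: ifPn => _; last exact: measurable0.
by apply: sub_sigma_algebra; exists (nth false s).
Qed.

Lemma zeta_measurable n : zeta n `<=` measurable.
Proof.
apply: smallest_sub; first exact: sigma_algebra_measurable.
by move=> _ [x _ <-]; exact: measurable_dyadic_interval.
Qed.

Lemma dyadic_interval_eq n (x y : dyadic_group) :
  dyadic_interval n x y -> dyadic_interval n y = dyadic_interval n x.
Proof.
move=> xy; apply/seteqP; split => z h k kn; first by rewrite h// xy.
by rewrite h// xy.
Qed.

Lemma is_cond_expP (R : realType) (mu : probability dyadic_group R)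
    (mu_haar : normalized_haar mu) n (f g : dyadic_group -> R) :
  mu.-integrable setT (EFin \o f) ->
  is_cond_exp mu n f g <-> g = cond_exp mu n f.
Proof.
move=> fi.
have mI x : measurable (dyadic_interval n x) by exact: measurable_dyadic_interval.
have muI x : mu (dyadic_interval n x) = (2 ^- n)%:E.
  by have/normalized_haarP := mu_haar.
have fI x : (\int[mu]_(y in dyadic_interval n x) (f y)%:E =
    (cond_exp mu n f x)%:E * mu (dyadic_interval n x))%E.
  rewrite /cond_exp muI /= -EFinM divfK ?invr_eq0 ?expf_neq0 ?pnatr_eq0//.
  rewrite /Rintegral fineK//.
  by apply: integrable_fin_num => //; exact: (integrableS measurableT).
have cst_int h x : (forall y, dyadic_interval n x y -> h y = h x) ->
    (\int[mu]_(y in dyadic_interval n x) (h y)%:E =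
     (h x)%:E * mu (dyadic_interval n x))%E.
  move=> hx; rewrite -integral_cst//; apply: eq_integral => y.
  by rewrite inE => /hx ->.
split=> [[gm gi gf]|->].
  apply/funext => x.
  have gx y : dyadic_interval n x y -> g y = g x.
    have /zetaP h := gm [set g x] (measurable_set1 _).
    by move=> xy; exact: (h x erefl y xy).
  have zI : zeta n (dyadic_interval n x) by apply: sub_sigma_algebra; exists x.
  have := gf _ zI; rewrite fI cst_int// muI -!EFinM => -[].
  by apply: mulIf; rewrite invr_eq0 expf_neq0 ?pnatr_eq0.
set c := cond_exp mu n f.
have cE x y : dyadic_interval n x y -> c y = c x.
  by move=> xy; rewrite /c /cond_exp (dyadic_interval_eq xy).
have cm B : zeta n (c @^-1` B).
  by apply/zetaP => x Bx y xy; rewrite /= (cE x).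
have mc : measurable_fun setT c.
  by move=> _ B mB; rewrite setTI; apply: (@zeta_measurable n); exact: cm.
pose rep (t : n.-tuple bool) : dyadic_group := nth false t.
have repP x : exists t, dyadic_interval n (rep t) x.
  exists (mktuple (fun i : 'I_n => x i)) => k kn.
  by rewrite /rep -[k]/(nat_of_ord (Ordinal kn)) -tnth_nth tnth_mktuple.
have ci : mu.-integrable setT (EFin \o c).
  apply: measurable_bounded_integrable => //.
    by rewrite (le_lt_trans (probability_le1 _ _)) ?ltry.
  exists (\sum_(t : n.-tuple bool) `|c (rep t)|); split; first exact: num_real.
  move=> M hM x _ /=; apply: le_trans (ltW hM).
  have [t xt] := repP x; rewrite (cE _ _ xt) (bigD1 t)//= lerDl.
  exact: sumr_ge0.
split=> // A zA.
pose AI (t : n.-tuple bool) := A `&` dyadic_interval n (rep t).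
have mAI t : measurable (AI t) by apply: measurableI => //; exact: zeta_measurable zA.
have tI : trivIset [set` index_enum (n.-tuple bool)] AI.
  move=> s t _ _ [x [[_ sx] [_ tx]]]; apply/eq_from_tnth => i.
  by rewrite !(tnth_nth false) -[LHS]/(rep s i) -[RHS]/(rep t i) -sx// -tx.
have -> : A = \big[setU/set0]_(t : n.-tuple bool) AI t.
  rewrite -bigcup_seq; apply/seteqP; split => [x Ax|x [t _ []]//].
  by have [t xt] := repP x; exists t => //=; exact: mem_index_enum.
have mf : measurable_fun setT f.
  by apply/measurable_EFinP; exact: measurable_int fi.
have mbig : measurable (\big[setU/set0]_(t : n.-tuple bool) AI t).
  exact: bigsetU_measurable.
rewrite !integral_bigsetU_EFin//; last 4 first.
- exact: index_enum_uniq.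
- by apply/measurable_EFinP; exact: measurable_funS mf.
- exact: index_enum_uniq.
- by apply/measurable_EFinP; exact: measurable_funS mc.
apply: eq_bigr => t _.
have [At|At] := pselect (A (rep t)).
  have -> : AI t = dyadic_interval n (rep t).
    by apply/setIidPr; move/zetaP: zA; exact.
  by rewrite fI cst_int// => y; exact: cE.
have -> : AI t = set0.
  rewrite -subset0 => x [Ax xt]; apply: At.
  by move/zetaP: zA => /(_ x Ax); apply => k kn; rewrite xt.
by rewrite !integral_set0.
Qed.

(* Main.v *)
(* (a) Write s = low_bit n and M = high_bit n + 1. The function S_n F is the
   convolution over rank-M cells of F_M with the Dirichlet kernel D_n, which
   vanishes off I_s(0) and is at most 2^(k+1) on I_k(0) \ I_(k+1)(0). Since
   (sum a_i)^p <= sum a_i^p for p < 1, a discrete Young inequality gives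
   \int |S_n F|^p <= C 2^(d(n)(1-p)) \int |F_M|^p, without any atomic
   decomposition. As E(S_n F | zeta_k) is F_k for k < M and S_n F for k >= M,
   the maximal function of S_n F is at most max(F^*, |S_n F|).

   (b) Let F_n = sum_(j < n) beta_j (D_(2^(j+1)) - D_(2^j)) with
   beta_j = b_j 2^(j(1/p-1)). The j-th term has size b_j 2^(j/p) on I_j(0), so
   |F^*|^p integrates to at most sum_j b_j^p. With N = high_bit m and
   s = low_bit m < N, flipping coordinate N of a point x of
   I_s(0) \ I_(s+1)(0) changes S_m F by 2 beta_N D_m(x), of modulus
   2 beta_N 2^s; hence |S_m F| is at least beta_N 2^s at x or at its flip. This
   bounds the weak quasi-norm of S_m F from below by a constant times
   b_N 2^(d(m)(1/p-1)), and it remains to choose b with sum_j b_j^p finite and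
   b_N 2^(d(m)(1/p-1)) / Phi(m) unbounded. *)
Require Import Defs.
From HB Require Import structures.
From mathcomp Require Import all_boot all_order all_algebra.
From mathcomp Require Import all_classical all_reals all_analysis.
From mathcomp Require Import measurable_realfun.
From mathcomp Require Import zify ring lra.
Set Implicit Arguments.
Unset Strict Implicit.
Unset Printing Implicit Defensive.
Import Order.TTheory GRing.Theory Num.Theory.
Import numFieldNormedType.Exports.
Local Open Scope classical_set_scope.
Local Open Scope ring_scope.

(** * Walsh functions and Dirichlet kernels *)

Lemma bit_small n j : (n < 2 ^ j)%N -> bit n j = false.
Proof. by move=> h; rewrite /bit divn_small. Qed.

Lemma bit_low t l i j : (j < t)%N -> bit (2 ^ t * l + i) j = bit i j.
Proof.
move=> jt; rewrite /bit -{1}(subnKC (ltnW jt)) expnD -mulnA mulnC.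
rewrite divnMDl ?expn_gt0// oddD oddM oddX subn_eq0 leqNgt jt.
by [].
Qed.

Lemma bit_high t l i j : (i < 2 ^ t)%N -> (t <= j)%N ->
  bit (2 ^ t * l + i) j = bit (2 ^ t * l) j.
Proof.
move=> it tj; rewrite /bit -(subnKC tj) expnD !divnMA.
by rewrite mulnC divnMDl ?expn_gt0// (divn_small it) addn0 mulnK// expn_gt0.
Qed.

Lemma bit_low0 t l j : (j < t)%N -> bit (2 ^ t * l) j = false.
Proof. by move=> jt; rewrite -(addn0 (2 ^ t * l)%N) bit_low// /bit div0n. Qed.

Lemma bit_trunc_log n : (0 < n)%N -> bit n (trunc_log 2 n).
Proof.
move=> n0; have /andP[h1 h2] := trunc_log_bounds (isT : 1 < 2)%N n0.
rewrite /bit (_ : n %/ _ = 1)%N//; apply/eqP.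
rewrite eqn_leq -ltnS ltn_divLR ?expn_gt0// leq_divRL ?expn_gt0//.
by rewrite mul1n h1 andbT -expnS.
Qed.

Lemma high_bit_trunc_log n : (0 < n)%N -> high_bit n = trunc_log 2 n.
Proof.
move=> n0; have /andP[h1 h2] := trunc_log_bounds (isT : 1 < 2)%N n0.
have jn : (trunc_log 2 n < n)%N by apply: leq_trans h1; exact: ltn_expl.
apply/eqP; rewrite eqn_leq; apply/andP; split.
  apply/bigmax_leqP => i; rewrite leqNgt; apply: contraL => ji.
  by rewrite bit_small// (leq_trans h2)// leq_exp2l.
exact: (@leq_bigmax_cond _ (fun j : 'I_n => bit n j) val (Ordinal jn)) (bit_trunc_log n0).
Qed.

Lemma high_bit_bounds n : (0 < n)%N -> (2 ^ high_bit n <= n < 2 ^ (high_bit n).+1)%N.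
Proof.
by move=> n0; rewrite high_bit_trunc_log//; exact: trunc_log_bounds.
Qed.

(** All digits below [low_bit n] vanish, so induction shows that this power of two divides n; the
    quotient is odd because its parity is the digit at [low_bit n]. *)
Lemma low_bitP n : (0 < n)%N -> exists2 q, odd q & n = (2 ^ low_bit n * q)%N.
Proof.
move=> n0; have /andP[h1 _] := trunc_log_bounds (isT : 1 < 2)%N n0.
have jn : (trunc_log 2 n < n)%N by apply: leq_trans h1; exact: ltn_expl.
have hb : has (bit n) (iota 0 n).
  by apply/hasP; exists (trunc_log 2 n); rewrite ?mem_iota ?bit_trunc_log.
have bl : bit n (low_bit n).
  have := nth_find 0%N hb; rewrite nth_iota ?add0n//.
  by rewrite -[X in (_ < X)%N](size_iota 0) -has_find.
have blt : {in gtn (low_bit n), forall j, bit n j = false}.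
  move=> j /[dup] jl /(before_find 0%N); rewrite nth_iota ?add0n//.
  by rewrite (leq_trans jl)// (leq_trans (find_size _ _))// size_iota.
exists (n %/ 2 ^ low_bit n)%N => //.
rewrite mulnC divnK//; elim: (low_bit n) blt => [_|t IH h]; first by rewrite dvd1n.
have /dvdnP[q nq] : (2 ^ t %| n)%N by apply: IH => j jt; apply: h; exact: ltnW.
move: (h t (leqnn _)); rewrite /bit nq mulnK ?expn_gt0// => /negbT.
by rewrite expnS dvdn_pmul2r ?expn_gt0// dvdn2.
Qed.

Lemma low_bit_le_high n : (0 < n)%N -> (low_bit n <= high_bit n)%N.
Proof.
move=> n0; have /andP[_ h] := high_bit_bounds n0.
have [q oq nq] := low_bitP n0.
rewrite -ltnS -(ltn_exp2l _ _ (isT : 1 < 2)%N) (leq_ltn_trans _ h)//.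
by rewrite [X in (_ <= X)%N]nq leq_pmulr// odd_gt0.
Qed.

Lemma high_bit_ge n j : (2 ^ j <= n)%N -> (j <= high_bit n)%N.
Proof.
move=> h; have n0 : (0 < n)%N by apply: leq_trans h; rewrite expn_gt0.
have /andP[_ h2] := high_bit_bounds n0.
by rewrite -ltnS -(ltn_exp2l _ _ (isT : 1 < 2)%N) (leq_ltn_trans h).
Qed.

Section walsh.
Context {R : realType}.
Implicit Types (x y : dyadic_group).

(** Digits from M on are zero and contribute factors 1. A common range M allows Walsh functions of
    different indices to be compared factor by factor. *)
Lemma walshE M n x : (n < 2 ^ M)%N ->
  walsh R n x = \prod_(k < M) rademacher R k x ^+ bit n k.
Proof.
have stable (f : nat -> R) a b : (a <= b)%N -> (forall k, (a <= k)%N -> f k = 1) ->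
    \prod_(k < a) f k = \prod_(k < b) f k.
  move=> ab f1; rewrite -!(big_mkord xpredT f) (big_cat_nat _ ab)//=.
  rewrite [X in _ * X]big_nat [X in _ * X]big1 ?mulr1// => k /andP[ak _].
  exact: f1.
move=> nM; rewrite /walsh.
have [h|/ltnW h] := leqP n M.
  apply: (stable (fun k => rademacher R k x ^+ bit n k)) => // k nk.
  by rewrite bit_small// (leq_ltn_trans nk)// ltn_expl.
symmetry; apply: (stable (fun k => rademacher R k x ^+ bit n k)) => // k Mk.
by rewrite bit_small// (leq_trans nM)// leq_exp2l.
Qed.

(** The digits of [2 ^ t * l] and of i occupy disjoint sets of positions, so each Rademacher factor
    comes from at most one of the two. *)
Lemma walshM_block t l i x : (i < 2 ^ t)%N ->
  walsh R (2 ^ t * l + i) x = walsh R (2 ^ t * l) x * walsh R i x.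
Proof.
move=> it; set M := (2 ^ t * l + i)%N.
have MM : (M < 2 ^ M)%N by exact: ltn_expl.
rewrite !(@walshE M)//; last 2 first.
- by rewrite (leq_ltn_trans _ MM)// leq_addl.
- by rewrite (leq_ltn_trans _ MM)// leq_addr.
rewrite -big_split /=; apply: eq_bigr => k _.
have [kt|tk] := ltnP k t; first by rewrite bit_low// bit_low0// mul1r.
rewrite bit_high// [bit i k]bit_small ?mulr1//.
by rewrite (leq_trans it)// leq_exp2l.
Qed.

Lemma rademacher_add k x y :
  rademacher R k (dyadic_add x y) = rademacher R k x * rademacher R k y.
Proof. exact: signr_addb. Qed.

Lemma walsh_add n x y : walsh R n (dyadic_add x y) = walsh R n x * walsh R n y.
Proof.
rewrite /walsh -big_split; apply: eq_bigr => k _.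
by rewrite rademacher_add exprMn.
Qed.

Lemma walsh_interval M n x y : (n < 2 ^ M)%N -> dyadic_interval M x y ->
  walsh R n y = walsh R n x.
Proof.
move=> nM xy; rewrite !(@walshE M)//; apply: eq_bigr => k _.
by rewrite /rademacher xy.
Qed.

Lemma normr_walsh n x : `|walsh R n x| = 1.
Proof.
rewrite /walsh normr_prod big1// => k _.
by rewrite /rademacher -exprM normr_sign.
Qed.

Lemma walsh_pow2 t x : walsh R (2 ^ t) x = rademacher R t x.
Proof.
rewrite (@walshE t.+1) ?ltn_exp2l//.
rewrite big_ord_recr /= big1 ?mul1r => [|k _].
  by rewrite /bit divnn expn_gt0.
by rewrite -[(2 ^ t)%N]muln1 bit_low0.
Qed.

Definition dirichlet (n : nat) x : R := \sum_(k < n) walsh R k x.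

Lemma dirichlet_block t l i x : (i <= 2 ^ t)%N ->
  dirichlet (2 ^ t * l + i) x =
  dirichlet (2 ^ t * l) x + walsh R (2 ^ t * l) x * dirichlet i x.
Proof.
move=> it; rewrite /dirichlet big_split_ord /=; congr (_ + _).
rewrite mulr_sumr; apply: eq_bigr => k _.
by rewrite walshM_block// (leq_trans (ltn_ord k)).
Qed.

(** The interval I_t(0) as a boolean predicate, so that [(near_zero t x)%:R] is its indicator
    function. *)
Definition near_zero t (x : dyadic_group) : bool := [forall j : 'I_t, ~~ x j].

Lemma near_zeroS t x : near_zero t.+1 x = near_zero t x && ~~ x t.
Proof.
apply/forallP/andP => [h|[/forallP h1 h2] j].
  split; last exact: (h ord_max).
  by apply/forallP => j; exact: (h (widen_ord (leqnSn t) j)).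
have := ltn_ord j; rewrite ltnS leq_eqVlt => /orP[/eqP->//|jt].
exact: (h1 (Ordinal jt)).
Qed.

(** Since D_(2^(t+1)) = (1 + r_t) D_(2^t), each further coordinate either doubles the value or kills
    it. *)
Lemma dirichlet_pow2 t x : dirichlet (2 ^ t) x = (near_zero t x)%:R * 2 ^+ t.
Proof.
elim: t => [|t IH].
  rewrite /dirichlet big_ord1 /walsh big_ord0 /near_zero expr0.
  by case: forallP => [|[] []//]; rewrite mulr1.
have -> : (2 ^ t.+1 = 2 ^ t * 1 + 2 ^ t)%N by rewrite expnS; lia.
rewrite dirichlet_block// muln1 walsh_pow2 IH near_zeroS /rademacher exprS.
by case: (near_zero t x); case: (x t) => /=; ring.
Qed.

(** The kernel splits into l blocks, each a Walsh function times D_(2^t), which vanishes off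
    I_t(0). *)
Lemma dirichlet_mul_eq0 t l x : ~~ near_zero t x -> dirichlet (2 ^ t * l) x = 0.
Proof.
move=> /negbTE h; elim: l => [|l IH]; first by rewrite muln0 /dirichlet big_ord0.
by rewrite mulnS addnC dirichlet_block// IH dirichlet_pow2 h mul0r mulr0 addr0.
Qed.

Lemma normr_dirichlet_le n x : `|dirichlet n x| <= n%:R.
Proof.
rewrite (le_trans (ler_norm_sum _ _ _))//.
under eq_bigr do rewrite normr_walsh.
by rewrite sumr_const card_ord.
Qed.

(** Off I_t(0) only the remainder of n modulo 2^t contributes, and it has fewer than 2^t terms of
    modulus 1. *)
Lemma normr_dirichlet_off t n x : ~~ near_zero t x -> `|dirichlet n x| <= 2 ^+ t.
Proof.
move=> h; rewrite (divn_eq n (2 ^ t)) mulnC dirichlet_block; last first.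
  by rewrite ltnW// ltn_mod expn_gt0.
rewrite dirichlet_mul_eq0// add0r normrM normr_walsh mul1r.
rewrite (le_trans (normr_dirichlet_le _ _))// -natrX ler_nat ltnW//.
by rewrite ltn_mod expn_gt0.
Qed.

(** For odd q, the kernel is that of an even multiple of 2^t, which vanishes because x is outside
    I_(t+1)(0), plus one block of modulus D_(2^t)(x). *)
Lemma normr_dirichlet_on t q x : odd q -> near_zero t x -> x t ->
  `|dirichlet (2 ^ t * q) x| = 2 ^+ t.
Proof.
move=> oq tx xt; rewrite -(odd_double_half q) oq add1n mulnS addnC.
rewrite dirichlet_block// -muln2 mulnC mulnAC -mulnA mulnC.
rewrite (_ : (_ * _ * _)%N = (2 ^ t.+1 * q./2)%N); last by rewrite expnS; lia.
rewrite dirichlet_mul_eq0 ?near_zeroS ?xt ?andbF//.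
by rewrite add0r normrM normr_walsh mul1r dirichlet_pow2 tx mul1r ger0_norm ?exprn_ge0.
Qed.

(** Adding this element flips coordinate N alone, which multiplies w_n by -1 exactly when the digit
    n_N is 1. *)
Definition unit_seq (N : nat) : dyadic_group := fun k => k == N.

Lemma walsh_unit_seq n N : walsh R n (unit_seq N) = (-1) ^+ bit n N.
Proof.
have h : (n < 2 ^ (n + N).+1)%N.
  by rewrite (leq_trans (ltn_expl n (isT : 1 < 2)%N))// leq_exp2l// -addnS leq_addr.
rewrite (@walshE (n + N).+1)//.
have NM : (N < (n + N).+1)%N by rewrite ltnS leq_addl.
rewrite (bigD1 (Ordinal NM))//= big1 ?mulr1 => [|k kN].
  by rewrite /rademacher /unit_seq eqxx.
rewrite /rademacher /unit_seq (_ : (_ == _) = false) ?expr1n//.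
by apply/negbTE; move: kN; rewrite -val_eqE.
Qed.

(** Off I_N(0) the first 2^N terms cancel. The others sum to r_N times a kernel that depends only on
    coordinates below N, so the flip acts through the sign of r_N. *)
Lemma dirichlet_flip N n x : (2 ^ N <= n <= 2 ^ N.+1)%N -> ~~ near_zero N x ->
  dirichlet n (dyadic_add x (unit_seq N)) = - dirichlet n x.
Proof.
move=> /andP[h1 h2] zx.
have Dn y : ~~ near_zero N y -> 
    dirichlet n y = walsh R (2 ^ N) y * dirichlet (n - 2 ^ N) y.
  move=> /negbTE zy; rewrite -{1}(subnKC h1) -{1}[(2 ^ N)%N]muln1 dirichlet_block.
    by rewrite muln1 dirichlet_pow2 zy mul0r add0r.
  by move: h2; rewrite expnS; lia.
have zxe : ~~ near_zero N (dyadic_add x (unit_seq N)).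
  apply: contra zx => /forallP h; apply/forallP => j; have := h j.
  by rewrite /dyadic_add /unit_seq (ltn_eqF (ltn_ord j)) addbF.
rewrite !Dn// walsh_add walsh_unit_seq /bit divnn expn_gt0 /= expr1 mulrN1 mulNr.
congr (- (_ * _)); apply: eq_bigr => k _.
apply: (@walsh_interval N).
  by rewrite (leq_trans (ltn_ord k))// leq_subLR addnn -mul2n -expnS.
by move=> j jN; rewrite /dyadic_add /unit_seq (ltn_eqF jN) addbF.
Qed.

End walsh.

(** * Functions of finite rank *)

Section level.
Context {R : realType} (mu : probability dyadic_group R).
Hypothesis mu_haar : normalized_haar mu.
Implicit Types (x y a : dyadic_group) (g : dyadic_group -> R).

(** A representative of each interval of rank M, continued by zeros; the tuples enumerate these
    intervals. *)
Definition cell {M} (t : M.-tuple bool) : dyadic_group := nth false t.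

Definition prefix M x : M.-tuple bool := [tuple x i | i < M].

Lemma cell_prefix M x : dyadic_interval M x (cell (prefix M x)).
Proof.
by move=> k kM; rewrite /cell -[k]/(nat_of_ord (Ordinal kM)) -tnth_nth tnth_mktuple.
Qed.

Lemma prefix_eq M x y : dyadic_interval M x y -> prefix M y = prefix M x.
Proof. by move=> h; apply/eq_from_tnth => i; rewrite !tnth_mktuple h. Qed.

Lemma prefix_cell M (t : M.-tuple bool) : prefix M (cell t) = t.
Proof. by apply/eq_from_tnth => i; rewrite tnth_mktuple (tnth_nth false). Qed.

(* For real-valued g this is measurability with respect to zeta M. *)
Definition level M g := forall x y, dyadic_interval M x y -> g y = g x.

Lemma level_leq M N g : (M <= N)%N -> level M g -> level N g.
Proof.
by move=> MN h x y xy; apply: h => k kM; apply: xy; exact: leq_trans MN.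
Qed.

Lemma level_cell M g x : level M g -> g (cell (prefix M x)) = g x.
Proof. by move=> h; apply: h; exact: cell_prefix. Qed.

Lemma zeta_preimage_level M g (B : set R) : level M g -> zeta M (g @^-1` B).
Proof. by move=> h; apply/zetaP => x Bx y xy; rewrite /= (h x). Qed.

Lemma measurable_level M g : level M g -> measurable_fun setT g.
Proof.
move=> h _ B mB; rewrite setTI; apply: (@zeta_measurable M).
exact: zeta_preimage_level.
Qed.

Lemma integrable_level M g : level M g -> mu.-integrable setT (EFin \o g).
Proof.
move=> h; apply: measurable_bounded_integrable => //.
- by rewrite (le_lt_trans (probability_le1 _ _)) ?ltry.
- exact: measurable_level h.
exists (\sum_(t : M.-tuple bool) `|g (cell t)|); split; first exact: num_real.
move=> C hC x _ /=; apply: le_trans (ltW hC).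
rewrite -(level_cell x h) (bigD1 (prefix M x))//= lerDl.
exact: sumr_ge0.
Qed.

(** The Haar integral of a function of rank M as a finite sum ([integral_level]); exchanging
    integrals and translating become manipulations of finite sums. *)
Definition avg M g : R := 2 ^- M * \sum_(t : M.-tuple bool) g (cell t).

Lemma integral_level M g : level M g -> (\int[mu]_x (g x)%:E = (avg M g)%:E)%E.
Proof.
move=> h; pose I (t : M.-tuple bool) := dyadic_interval M (cell t).
have -> : [set: dyadic_group] = \big[setU/set0]_(t : M.-tuple bool) I t.
  rewrite -bigcup_seq; apply/seteqP; split => [x _|//].
  exists (prefix M x) => /=; first exact: mem_index_enum.
  by move=> k kM; rewrite (@cell_prefix M x).
rewrite integral_bigsetU_EFin//; last 4 first.
- by move=> t; exact: measurable_dyadic_interval.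
- exact: index_enum_uniq.
- move=> s t _ _ [x [sx tx]]; rewrite -(prefix_cell s) -(prefix_cell t).
  by rewrite -(prefix_eq sx) (prefix_eq tx).
- apply/measurable_EFinP; apply: measurable_funTS.
  exact: measurable_level h.
rewrite /avg mulr_sumr -sumEFin; apply: eq_bigr => t _.
rewrite (eq_integral (cst (g (cell t))%:E)) => [|x]; last first.
  by rewrite inE => /h ->.
rewrite integral_cst; last exact: measurable_dyadic_interval.
have /normalized_haarP/(_ M (cell t)) muI := mu_haar.
rewrite [X in (_ * X)%E](_ : _ = (2 ^- M)%:E) -?EFinM 1?mulrC//.
Qed.

Lemma Rintegral_level M g : level M g -> \int[mu]_x g x = avg M g.
Proof. by move=> h; rewrite /Rintegral (integral_level h). Qed.

Lemma level_add M a g : level M g -> level M (g \o dyadic_add a).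
Proof. by move=> h x y xy; apply: h => k kM; rewrite /dyadic_add xy. Qed.

(** Translation by a permutes the intervals of rank M, being an involution on them. *)
Lemma avg_add M a g : level M g -> avg M (g \o dyadic_add a) = avg M g.
Proof.
move=> h; rewrite /avg; congr (_ * _).
pose f (t : M.-tuple bool) := prefix M (dyadic_add a (cell t)).
have fK : involutive f.
  move=> t; rewrite -[RHS]prefix_cell /f; apply: prefix_eq => k kM.
  by rewrite /dyadic_add cell_prefix// addbA addbb.
rewrite [RHS](reindex_inj (inv_inj fK)); apply: eq_bigr => t _ /=.
by rewrite (level_cell _ h).
Qed.

Lemma is_cond_exp_level M g : level M g -> is_cond_exp mu M g g.
Proof.
move=> h; split => // [B _|]; first exact: zeta_preimage_level.
exact: integrable_level h.
Qed.

Lemma cond_exp_id M N g : (M <= N)%N -> level M g -> cond_exp mu N g = g.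
Proof.
move=> MN /(level_leq MN) h; symmetry; apply/is_cond_expP => //.
  exact: integrable_level h.
exact: is_cond_exp_level.
Qed.

Lemma dyadic_addC x y : dyadic_add x y = dyadic_add y x.
Proof. by apply/funext => k; rewrite /dyadic_add addbC. Qed.

Lemma near_zero_add k x y : dyadic_interval k x y <-> near_zero k (dyadic_add x y).
Proof.
split=> [xy|/forallP h j jk].
  by apply/forallP => j; rewrite /dyadic_add xy// addbb.
by move: (h (Ordinal jk)); rewrite /dyadic_add /=; case: (x j); case: (y j).
Qed.

Lemma level_dirichlet M n : (n <= 2 ^ M)%N -> level M (@dirichlet R n).
Proof.
move=> nM x y xy; apply: eq_bigr => k _; apply: (walsh_interval _ xy).
exact: leq_trans nM.
Qed.

Lemma levelM M g h : level M g -> level M h -> level M (fun x => g x * h x).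
Proof. by move=> lg lh x y xy; rewrite (lg _ _ xy) (lh _ _ xy). Qed.

(** As a function of y, D_(2^k)(x + y) is the indicator of I_k(x) divided by its measure, so
    conditioning is a convolution. *)
Lemma cond_exp_dirichlet k M g x : (k <= M)%N -> level M g ->
  cond_exp mu k g x = avg M (fun y => dirichlet (2 ^ k) (dyadic_add x y) * g y).
Proof.
move=> kM lg; rewrite /cond_exp; have /normalized_haarP -> := mu_haar.
rewrite /= invrK -Rintegral_level; last first.
  apply: levelM => //; apply: level_add; apply: level_dirichlet.
  by rewrite leq_exp2l.
rewrite /Rintegral [X in fine X](integral_mkcond (dyadic_interval k x)).
have -> : ((fun y => (g y)%:E) \_ (dyadic_interval k x) =
    EFin \o (fun y => ((near_zero k (dyadic_add x y))%:R * g y)%R))%E.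
  apply/funext => y; rewrite /patch /=; have [xy|xy] := boolP (near_zero _ _).
    by rewrite mem_set ?mul1r//; exact/near_zero_add.
  rewrite memNset ?mul0r// => /near_zero_add; exact/negP.
have lz : level k (fun y => (near_zero k (dyadic_add x y))%:R : R).
  move=> u v uv; congr ((nat_of_bool _)%:R); apply/idP/idP;
  by rewrite -!near_zero_add => + j jk => /(_ j jk) <-; rewrite uv.
rewrite [X in fine X * _](@integral_level M); last exact/levelM/lg/(level_leq kM lz).
rewrite [X in _ = fine X](@integral_level M) /=; last first.
  apply: levelM => //; apply: level_add; apply: level_dirichlet.
  by rewrite leq_exp2l.
rewrite mulrC /avg mulrCA; congr (_ * _); rewrite mulr_sumr; apply: eq_bigr => t _.
by rewrite dirichlet_pow2; ring.
Qed.

End level.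

(** * Partial sums of martingales *)

Section partial_sums.
Context {R : realType} (mu : probability dyadic_group R).
Hypothesis mu_haar : normalized_haar mu.
Implicit Types (x y a : dyadic_group) (g : dyadic_group -> R).

Lemma eq_avg M (f g : dyadic_group -> R) : f =1 g -> avg M f = avg M g.
Proof. by move=> fg; congr (_ * _); apply: eq_bigr => t _. Qed.

Lemma avgZ M (c : R) g : avg M (fun x => c * g x) = c * avg M g.
Proof. by rewrite /avg mulrCA; congr (_ * _); rewrite mulr_sumr. Qed.

Lemma avg_sum (I : finType) M (f : I -> dyadic_group -> R) :
  avg M (fun x => \sum_i f i x) = \sum_i avg M (f i).
Proof. by rewrite /avg exchange_big /= mulr_sumr. Qed.

Lemma avg_avg M N (f : dyadic_group -> dyadic_group -> R) :
  avg M (fun x => avg N (f x)) = avg N (fun y => avg M (f ^~ y)).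
Proof.
rewrite /avg; under eq_bigr do rewrite mulr_sumr.
under [in RHS]eq_bigr do rewrite mulr_sumr.
rewrite exchange_big /= !mulr_sumr; apply: eq_bigr => s _.
by rewrite !mulr_sumr; apply: eq_bigr => t _; rewrite mulrCA.
Qed.

(** After exchanging the two averages, the symmetric kernel D_(2^k)(x + y) acts on g instead of f,
    and reproduces g because g has rank k. *)
Lemma avg_cond_exp k M (f g : dyadic_group -> R) : (k <= M)%N ->
  level M f -> level k g ->
  avg k (fun x => cond_exp mu k f x * g x) = avg M (fun x => f x * g x).
Proof.
move=> kM lf lg.
under eq_avg => x do rewrite (cond_exp_dirichlet mu_haar _ kM lf) mulrC -avgZ.
rewrite avg_avg; apply: eq_avg => y.
have := cond_exp_dirichlet mu_haar y (leqnn k) lg.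
rewrite (cond_exp_id mu_haar (leqnn k) lg) => ->.
rewrite -avgZ; apply: eq_avg => x.
by rewrite (dyadic_addC y); ring.
Qed.

Lemma level_walsh M n : (n < 2 ^ M)%N -> level M (walsh R n).
Proof. by move=> nM x y xy; exact: (walsh_interval nM). Qed.

(** If n is at least 2^k, its top digit sits at a position not below k. Flipping that coordinate
    preserves the kernel D_(2^k) and negates w_n, so the average equals its own opposite. *)
Lemma cond_exp_walsh k n x : cond_exp mu k (walsh R n) x =
  (n < 2 ^ k)%N%:R * walsh R n x.
Proof.
have [nk|kn] := ltnP n (2 ^ k)%N.
  by rewrite mul1r (cond_exp_id mu_haar (leqnn k))//; exact: level_walsh.
rewrite mul0r.
pose M := maxn k n; have kM : (k <= M)%N by rewrite leq_maxl.
have lw : level M (walsh R n).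
  by apply: level_walsh; rewrite (leq_ltn_trans _ (ltn_expl _ _))// leq_maxr.
have lD : level M (fun y => dirichlet (2 ^ k) (dyadic_add x y) * walsh R n y).
  apply: levelM => //; apply: level_add; apply: level_dirichlet.
  by rewrite leq_exp2l.
rewrite (cond_exp_dirichlet mu_haar x kM lw).
have n0 : (0 < n)%N by apply: leq_trans kn; rewrite expn_gt0.
have bn := bit_trunc_log n0; have kN : (k <= trunc_log 2 n)%N by rewrite trunc_log_max.
suff h : avg M (fun y => dirichlet (2 ^ k) (dyadic_add x y) * walsh R n y) =
    - avg M (fun y => dirichlet (2 ^ k) (dyadic_add x y) * walsh R n y).
  by apply/eqP; move/eqP: h; rewrite -addr_eq0 -mulr2n mulrn_eq0.
rewrite -{1}(avg_add (unit_seq (trunc_log 2 n)) lD).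
rewrite -mulN1r -avgZ; apply: eq_avg => y /=.
rewrite walsh_add walsh_unit_seq bn.
rewrite (_ : dirichlet _ _ = dirichlet (2 ^ k) (dyadic_add x y)); last first.
  apply: (level_dirichlet (leqnn _)) => j jk; rewrite /dyadic_add /unit_seq.
  by rewrite ltn_eqF ?addFb// (leq_trans jk).
by rewrite expr1; ring.
Qed.

Lemma cond_exp_sum k M n (c : nat -> R) (h : nat -> dyadic_group -> R) x :
  (k <= M)%N -> (forall i, (i < n)%N -> level M (h i)) ->
  cond_exp mu k (fun y => \sum_(i < n) c i * h i y) x =
  \sum_(i < n) c i * cond_exp mu k (h i) x.
Proof.
move=> kM lh; rewrite (cond_exp_dirichlet mu_haar x kM); last first.
  by move=> y z yz; apply: eq_bigr => i _; rewrite (lh i (ltn_ord i) y z yz).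
under eq_avg do rewrite mulr_sumr.
rewrite avg_sum; apply: eq_bigr => i _.
rewrite (cond_exp_dirichlet mu_haar x kM)// -?avgZ; last exact: lh.
by apply: eq_avg => y; rewrite mulrCA.
Qed.

Variable F : nat -> dyadic_group -> R.
Hypothesis martF : martingale mu F.

Lemma level_martingale n : level n (F n).
Proof.
move=> x y xy; have [h _ _] := martF n.
by have /zetaP/(_ x erefl y xy) := h [set F n x] (measurable_set1 _).
Qed.

Lemma martingaleE n : F n = cond_exp mu n (F n.+1).
Proof.
apply/is_cond_expP => //; exact: integrable_level (level_martingale (n := n.+1)).
Qed.

Lemma avg_martingale M N g : (M <= N)%N -> level M g ->
  avg N (fun x => F N x * g x) = avg M (fun x => F M x * g x).
Proof.
move=> + lg; elim: N => [|N IH]; first by rewrite leqn0 => /eqP ->.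
rewrite leq_eqVlt => /orP[/eqP->//|MN]; rewrite -IH//.
rewrite [in RHS]martingaleE (avg_cond_exp (leqnSn N))//.
  exact: level_martingale.
exact: level_leq lg.
Qed.

(** The martingale property makes the sequence that defines the coefficient constant from M on,
    since w_k has rank M. *)
Lemma walsh_coef_avg M k : (k < 2 ^ M)%N ->
  walsh_coef mu F k = avg M (fun x => F M x * walsh R k x).
Proof.
move=> kM; apply: lim_near_cst => //.
exists M => // n /= Mn; rewrite (Rintegral_level mu_haar (M := n)).
  exact: (avg_martingale Mn (level_walsh kM)).
apply: levelM; first exact: level_martingale.
exact: (level_leq Mn (level_walsh kM)).
Qed.

(** The characters satisfy w_k(x) w_k(t) = w_k(x + t), which turns the partial sum into the
    convolution of F_M with D_n. *)
Lemma partial_sum_avg M n x : (n <= 2 ^ M)%N ->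
  partial_sum mu n F x = avg M (fun t => F M t * dirichlet n (dyadic_add x t)).
Proof.
move=> nM; rewrite /partial_sum /dirichlet.
under eq_avg do rewrite mulr_sumr.
rewrite avg_sum; apply: eq_bigr => k _.
rewrite (walsh_coef_avg (M := M)); last exact: leq_trans nM.
by rewrite mulrC -avgZ; apply: eq_avg => t; rewrite walsh_add; ring.
Qed.

Lemma level_partial_sum M n : (n <= 2 ^ M)%N -> level M (partial_sum mu n F).
Proof.
move=> nM x y xy; apply: eq_bigr => k _.
by rewrite (level_walsh (leq_trans (ltn_ord k) nM) xy).
Qed.

Lemma partial_sum_pow2 k : partial_sum mu (2 ^ k) F = F k.
Proof.
apply/funext => x; rewrite (partial_sum_avg _ (leqnn _)).
under eq_avg do rewrite mulrC.
have lF := @level_martingale k.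
by rewrite -(cond_exp_dirichlet mu_haar x (leqnn k) lF) (cond_exp_id mu_haar (leqnn k)).
Qed.

(** Conditioning on [zeta k] drops the frequencies from 2^k on and leaves S_(2^k) F. *)
Lemma cond_exp_partial_sum k n : (2 ^ k <= n)%N ->
  cond_exp mu k (partial_sum mu n F) = F k.
Proof.
move=> kn; apply/funext => x; rewrite -[RHS]/(F k x) -partial_sum_pow2.
rewrite (cond_exp_sum (M := maxn k n)) ?leq_maxl//; last first.
  move=> i ni; apply: level_walsh.
  by rewrite (leq_ltn_trans _ (ltn_expl _ _))// (leq_trans (ltnW ni))// leq_maxr.
under eq_bigr do rewrite cond_exp_walsh.
rewrite /partial_sum.
rewrite -(big_mkord xpredT
  (fun i => walsh_coef mu F i * ((i < 2 ^ k)%N%:R * walsh R i x))).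
rewrite -(big_mkord xpredT (fun i => walsh_coef mu F i * walsh R i x)).
rewrite (big_cat_nat _ kn)//=.
rewrite [X in _ + X]big_nat [X in _ + X]big1 ?addr0 => [|i /andP[ki _]].
  by apply: eq_big_nat => i /andP[_ ->]; rewrite mul1r.
by rewrite ltnNge ki mul0r mulr0.
Qed.

End partial_sums.

(** * Part (a) *)

Section power_estimates.
Context {R : realType} (p : R).
Hypotheses (p_gt0 : 0 < p) (p_lt1 : p < 1).

Lemma powR_add_le (a b : R) : 0 <= a -> 0 <= b ->
  (a + b) `^ p <= a `^ p + b `^ p.
Proof.
move=> a0 b0; have := addr_ge0 a0 b0; rewrite le_eqVlt => /orP[/eqP <-|s0].
  by rewrite powR0 ?gt_eqF// addr_ge0 ?powR_ge0.
(* The ratio c / (a + b) is at most 1, so the power p < 1 does not decrease it; for c = a and c = b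
   the ratios add up to 1. *)
have frac c : 0 <= c -> c <= a + b -> c / (a + b) * (a + b) `^ p <= c `^ p.
  rewrite le_eqVlt => /orP[/eqP <-|c0] cs; first by rewrite !mul0r powR_ge0.
  have -> : c `^ p = (c / (a + b)) `^ p * (a + b) `^ p.
    by rewrite -powRM ?divfK ?gt_eqF// ?divr_ge0// ltW.
  rewrite ler_wpM2r ?powR_ge0//; apply: ger1_powR; last exact: ltW.
  by rewrite divr_gt0//= ler_pdivrMr// mul1r.
apply: le_trans (lerD (frac a a0 _) (frac b b0 _)); rewrite ?lerDl ?lerDr//.
by rewrite -mulrDl -mulrDl divff ?mul1r// gt_eqF.
Qed.

Lemma powR_sum_le (I : Type) (s : seq I) (f : I -> R) : (forall i, 0 <= f i) ->
  (\sum_(i <- s) f i) `^ p <= \sum_(i <- s) f i `^ p.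
Proof.
move=> f0; elim: s => [|i s IH]; first by rewrite !big_nil powR0 ?gt_eqF.
rewrite !big_cons (le_trans (powR_add_le _ _))// ?sumr_ge0// lerD2l.
exact: IH.
Qed.

Lemma sum_geometric_le (r : R) s M : 0 <= r < 1 ->
  \sum_(s <= k < M) r ^+ k <= r ^+ s / (1 - r).
Proof.
move=> /andP[r0 r1]; have r1' : 0 < 1 - r by rewrite subr_gt0.
rewrite ler_pdivlMr// mulr_suml.
have [sM|Ms] := leqP s M; last by rewrite big_geq ?exprn_ge0// ltnW.
rewrite (eq_bigr (fun k => - r ^+ k.+1 - - r ^+ k)) => [|k _]; last first.
  by rewrite exprS; ring.
by rewrite telescope_sumr// opprK addrC lerBlDr lerDl exprn_ge0.
Qed.

(** The ratio of the terms 2^(kp) 2^(-k): the p-th power of a kernel of size 2^k times the measure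
    of I_k(0). *)
Definition geom_ratio : R := 2 `^ (p - 1).

Lemma geom_ratio_gt0 : 0 < geom_ratio. Proof. exact: powR_gt0. Qed.

Lemma geom_ratio_lt1 : geom_ratio < 1.
Proof.
rewrite /geom_ratio /powR pnatr_eq0 /= expR_lt1 pmulr_llt0 ?subr_lt0//.
by rewrite ln_gt0// ltr1n.
Qed.

End power_estimates.

(** * Discrete Young inequality and the p-th mean of a partial sum *)

Section partial_sum_estimate.
Context {R : realType} (mu : probability dyadic_group R).
Hypothesis mu_haar : normalized_haar mu.
Context (p : R).
Hypotheses (p_gt0 : 0 < p) (p_lt1 : p < 1).
Implicit Types (x y : dyadic_group) (g : dyadic_group -> R).

Lemma le_avg M g (h : dyadic_group -> R) : (forall x, g x <= h x) -> avg M g <= avg M h.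
Proof.
by move=> gh; rewrite ler_wpM2l ?invr_ge0 ?exprn_ge0//; apply: ler_sum => t _.
Qed.

Lemma level_normr_powR M g : level M g -> level M (fun x => `|g x| `^ p).
Proof. by move=> lg x y xy; rewrite (lg x y xy). Qed.

Lemma dyadic_add0 x : dyadic_add (fun=> false) x = x.
Proof. exact/funext. Qed.

Lemma avg_near_zero k M : (k <= M)%N -> avg M (fun x => (near_zero k x)%:R : R) = 2 ^- k.
Proof.
move=> kM; have l1 : level M (fun=> 1 : R) by [].
have l0 : level 0 (fun=> 1 : R) by [].
have := cond_exp_dirichlet mu_haar (fun=> false) kM l1.
rewrite (cond_exp_id mu_haar (leq0n k) l0) => h.
transitivity (2 ^- k *
  avg M (fun x => dirichlet (2 ^ k) (dyadic_add (fun=> false) x) * 1) : R).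
  rewrite -avgZ; apply: eq_avg => x; rewrite mulr1 dyadic_add0 dirichlet_pow2.
  by rewrite mulrCA mulVf ?mulr1// expf_neq0.
by rewrite -h mulr1.
Qed.

(** A point lies off I_s(0), in I_M(0), or in one shell I_k(0) \ I_(k+1)(0) with s <= k < M. The
    kernel vanishes in the first case; otherwise a single term of the sum dominates it. *)
Lemma normr_dirichlet_powR_le s q M x : (0 < q)%N -> (2 ^ s * q <= 2 ^ M)%N ->
  `|dirichlet (2 ^ s * q) x : R| `^ p <=
  \sum_(s <= k < M.+1) (2 ^+ k.+1) `^ p * (near_zero k x)%:R.
Proof.
move=> q0 nM; have sM : (s <= M)%N.
  by rewrite -(leq_exp2l _ _ (isT : 1 < 2)%N) (leq_trans _ nM)// leq_pmulr.
have term0 (k : nat) : 0 <= (2 ^+ k.+1) `^ p * (near_zero k x)%:R :> R.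
  by rewrite mulr_ge0 ?powR_ge0.
have term k : (s <= k <= M)%N -> near_zero k x ->
    `|dirichlet (2 ^ s * q) x : R| <= 2 ^+ k.+1 ->
    `|dirichlet (2 ^ s * q) x : R| `^ p <=
    \sum_(s <= k < M.+1) (2 ^+ k.+1) `^ p * (near_zero k x)%:R.
  move=> /andP[sk kM] kx h; rewrite (big_cat_nat sk (leqW kM)) /=.
  rewrite [X in _ + X]big_ltn ?ltnS//=.
  rewrite kx mulr1 addrCA -[leLHS]addr0 lerD ?addr_ge0 ?sumr_ge0//.
  by rewrite ge0_ler_powR ?nnegrE// ltW.
have [sx|sx] := boolP (near_zero s x); last first.
  by rewrite dirichlet_mul_eq0// normr0 powR0 ?gt_eqF// sumr_ge0.
have [Mx|Mx] := boolP (near_zero M x).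
  apply: (term M); rewrite ?sM ?leqnn//.
  rewrite (le_trans (normr_dirichlet_le _ _))// -natrX ler_nat (leq_trans nM)//.
  by rewrite leq_exp2l.
have [k [/andP[sk kM] kx kx']] : exists k,
    [/\ (s <= k < M)%N, near_zero k x & ~~ near_zero k.+1 x].
  clear - sM sx Mx; elim: M sM Mx => [|M IH].
    by rewrite leqn0 => /eqP <-; rewrite sx.
  rewrite leq_eqVlt => /orP[/eqP <-|sM Mx]; first by rewrite sx.
  have [Mx'|Mx'] := boolP (near_zero M x).
    by exists M; rewrite -ltnS sM ltnSn.
  have [k [/andP[? /ltnW ?] ? ?]] := IH sM Mx'.
  by exists k; rewrite ltnS; split => //; apply/andP.
apply: (term k) => //; first by rewrite sk ltnW.
exact: normr_dirichlet_off.
Qed.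

Lemma powR_exprn (a : R) k : 0 <= a -> (a ^+ k) `^ p = (a `^ p) ^+ k.
Proof.
move=> a0; elim: k => [|k IH]; first by rewrite !expr0 powR1.
by rewrite !exprS powRM ?exprn_ge0// IH.
Qed.

Lemma geom_ratioE : geom_ratio p = 2 `^ p / 2.
Proof. by rewrite /geom_ratio powRB ?pnatr_eq0 ?implybT// powRr1. Qed.

Lemma avg_dirichlet_powR_le s q M : (0 < q)%N -> (2 ^ s * q <= 2 ^ M)%N ->
  avg M (fun x => `|dirichlet (2 ^ s * q) x : R| `^ p) <=
  2 `^ p * (geom_ratio p ^+ s / (1 - geom_ratio p)).
Proof.
move=> q0 nM; apply: le_trans (le_avg _ (fun x => normr_dirichlet_powR_le x q0 nM)) _.
rewrite [X in X <= _](_ : _ = \sum_(s <= k < M.+1) 2 `^ p * geom_ratio p ^+ k).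
  rewrite -mulr_sumr ler_wpM2l ?powR_ge0// sum_geometric_le//.
  by rewrite ltW ?geom_ratio_gt0//= geom_ratio_lt1.
transitivity (\sum_(s <= k < M.+1)
    (2 ^+ k.+1) `^ p * avg M (fun x => (near_zero k x)%:R)).
  rewrite /avg exchange_big mulr_sumr; apply: eq_bigr => k _.
  by rewrite mulrCA; congr (_ * _); rewrite -mulr_sumr.
rewrite !big_nat; apply: eq_bigr => k /andP[_ kM].
by rewrite avg_near_zero// powR_exprn// geom_ratioE exprS expr_div_n mulrA.
Qed.

(** Subadditivity is applied to the sum over cells. The factor [geom_ratio p ^- M] = 2^(M(1-p)) is
    the cost of taking the weight 2^(-M) out of the p-th power. *)
Lemma powR_avg_le M g :
  `|avg M g| `^ p <= geom_ratio p ^- M * avg M (fun x => `|g x| `^ p).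
Proof.
have E : (2 ^- M) `^ p = geom_ratio p ^- M * 2 ^- M :> R.
  have h : (2 ^- M) `^ p * (2 ^+ M) `^ p = 1 :> R.
    by rewrite -powRM ?invr_ge0 ?exprn_ge0// mulVf ?powR1// expf_neq0.
  rewrite -invfM -exprMn geom_ratioE divfK//; apply: (mulIf (x := (2 ^+ M) `^ p)).
    by rewrite gt_eqF// powR_gt0// exprn_gt0.
  by rewrite h powR_exprn// mulVf// expf_neq0// gt_eqF// powR_gt0.
rewrite /avg normrM powRM// ger0_norm ?invr_ge0 ?exprn_ge0// E -mulrA.
rewrite ler_wpM2l ?invr_ge0 ?exprn_ge0 ?(ltW (geom_ratio_gt0 _))//.
rewrite ler_wpM2l ?invr_ge0 ?exprn_ge0//.
apply: le_trans (powR_sum_le _ _ _ _) => //.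
by rewrite ge0_ler_powR ?nnegrE ?sumr_ge0// ?ler_norm_sum// ltW.
Qed.

(** [powR_avg_le] holds at each x; exchanging the averages and translating in x separates the two
    factors. *)
Lemma avg_convolution_le M g (h : dyadic_group -> R) : level M g -> level M h ->
  avg M (fun x => `|avg M (fun t => g t * h (dyadic_add x t))| `^ p) <=
  geom_ratio p ^- M * (avg M (fun x => `|g x| `^ p) * avg M (fun x => `|h x| `^ p)).
Proof.
move=> lg lh; apply: le_trans (le_avg _ (fun x => powR_avg_le M _)) _.
rewrite avgZ avg_avg; rewrite le_eqVlt; apply/orP; left; apply/eqP; congr (_ * _).
rewrite mulrC -avgZ; apply: eq_avg => t.
rewrite -(avg_add t (level_normr_powR lh)) mulrC -avgZ; apply: eq_avg => x /=.
by rewrite normrM powRM// dyadic_addC.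
Qed.

Variable F : nat -> dyadic_group -> R.
Hypothesis martF : martingale mu F.

Definition partial_sum_const : R := 2 * (1 - geom_ratio p)^-1.

Lemma avg_partial_sum_le n (M := (high_bit n).+1) : (0 < n)%N ->
  avg M (fun x => `|partial_sum mu n F x| `^ p) <=
  partial_sum_const * geom_ratio p ^- bit_width n * avg M (fun x => `|F M x| `^ p).
Proof.
move=> n0; have [q oq nq] := low_bitP n0; have /andP[_ /ltnW nM] := high_bit_bounds n0.
rewrite -/M in nM.
rewrite (eq_avg _ (fun x => congr1 (fun z => `|z| `^ p)
  (partial_sum_avg mu_haar martF x nM))).
apply: le_trans (avg_convolution_le _ _) _.
- exact: level_martingale.
- exact: level_dirichlet.
rewrite mulrCA [leRHS]mulrC ler_wpM2l//.
  by rewrite mulr_ge0 ?invr_ge0 ?exprn_ge0// sumr_ge0// => t _; exact: powR_ge0.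
have q0 := odd_gt0 oq.
have H : (2 ^ low_bit n * q <= 2 ^ M)%N by rewrite -nq.
have := avg_dirichlet_powR_le q0 H; rewrite -nq => h.
apply: le_trans (ler_wpM2l _ h) _.
  by rewrite invr_ge0 exprn_ge0// ltW// geom_ratio_gt0.
(* With r the geometric ratio, M = d(n) + s + 1 and 2^p = 2r, so r^(-M) 2^p r^s / (1 - r) is exactly
   2 r^(-d(n)) / (1 - r). *)
rewrite le_eqVlt; apply/orP; left; apply/eqP.
rewrite /M /bit_width /partial_sum_const -{1}(subnK (low_bit_le_high n0)).
have r0 := lt0r_neq0 (geom_ratio_gt0 p).
have -> : 2 `^ p = 2 * geom_ratio p by rewrite geom_ratioE; field.
rewrite -/(bit_width n); have : 1 - geom_ratio p != 0.
  by rewrite subr_eq0 gt_eqF// geom_ratio_lt1.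
move=> r1; rewrite exprS exprD; field.
by rewrite r0 r1 !expf_neq0.
Qed.

End partial_sum_estimate.

(** * Maximal functions and the Hardy quasi-norm of a partial sum *)

Section maximal.
Context {R : realType} (mu : probability dyadic_group R).
Hypothesis mu_haar : normalized_haar mu.
Context (p : R).
Hypotheses (p_gt0 : 0 < p) (p_lt1 : p < 1).
Implicit Types (x y : dyadic_group) (g : dyadic_group -> R).

Lemma maximal_function_ub (F : nat -> dyadic_group -> R) n x :
  (`|F n x|%:E <= maximal_function F x)%E.
Proof. by apply: ereal_sup_ubound; exists n. Qed.

Lemma maximal_function_ge0 (F : nat -> dyadic_group -> R) x :
  (0 <= maximal_function F x)%E.
Proof. by apply: le_trans (maximal_function_ub F 0 x); rewrite lee_fin. Qed.

Lemma measurable_maximal_function (F : nat -> dyadic_group -> R) :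
  (forall n, measurable_fun setT (F n)) -> measurable_fun setT (maximal_function F).
Proof.
move=> mF.
rewrite (_ : maximal_function F = fun x => esups (fun n => `|F n x|%:E) 0%N).
  apply: measurable_fun_esups => n; apply/measurable_EFinP.
  exact: measurableT_comp.
apply/funext => x; congr ereal_sup; apply/seteqP; split => [_ [n _ <-]|_ [n _ <-]].
  by exists n.
by exists n.
Qed.

Lemma hardy_norm_powR (F : nat -> dyadic_group -> R) :
  (hardy_norm mu p F `^ p = \int[mu]_x (maximal_function F x `^ p))%E.
Proof.
rewrite poweR_Lnorm ?gt_eqF//; apply: eq_integral => x _.
by rewrite gee0_abs// maximal_function_ge0.
Qed.

Lemma le_poweR (a b : \bar R) : (0 <= a -> a <= b -> a `^ p <= b `^ p)%E.
Proof.
move=> a0 ab; apply: gt0_ler_poweR => //; first exact: ltW.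
  by rewrite in_itv/= a0 leey.
by rewrite in_itv/= (le_trans a0 ab) leey.
Qed.

Lemma measurable_maximal_poweR (F : nat -> dyadic_group -> R) :
  (forall n, measurable_fun setT (F n)) ->
  measurable_fun setT (fun x => (maximal_function F x `^ p)%E).
Proof.
move=> mF; apply: (measurableT_comp (measurable_poweR p)).
exact: measurable_maximal_function.
Qed.

Lemma integral_level_powR M g : level M g ->
  (\int[mu]_x (`|g x|%:E `^ p) = (avg M (fun x => `|g x| `^ p))%:E)%E.
Proof.
move=> lg; rewrite -(integral_level mu_haar); last exact: level_normr_powR.
by apply: eq_integral => x _; rewrite poweR_EFin.
Qed.

Lemma hardy_norm_partial_sum_powR (F : nat -> dyadic_group -> R) n :
  martingale mu F -> (0 < n)%N ->
  (hardy_norm mu p (fun k => cond_exp mu k (partial_sum mu n F)) `^ p <=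
   ((1 + partial_sum_const p) * geom_ratio p ^- bit_width n)%:E *
   hardy_norm mu p F `^ p)%E.
Proof.
move=> martF n0; set M := (high_bit n).+1; set S := partial_sum mu n F.
have /andP[n1 /ltnW n2] := high_bit_bounds n0; rewrite -/M in n2.
have lS : level M S by exact: level_partial_sum.
have mF k : measurable_fun setT (F k).
  by apply: (measurable_level (M := k)); exact: level_martingale.
have mS : measurable_fun setT S by exact: measurable_level lS.
have cE k : cond_exp mu k S = if (k < M)%N then F k else S.
  case: ltnP => [kM|Mk]; last exact: cond_exp_id lS.
  by apply: cond_exp_partial_sum => //; rewrite (leq_trans _ n1)// leq_exp2l.
rewrite !hardy_norm_powR.
have mS' : measurable_fun setT (fun x => (`|S x|%:E `^ p)%E).
  apply: (measurableT_comp (measurable_poweR p)); apply/measurable_EFinP.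
  exact: measurableT_comp.
apply: (@le_trans _ _ (\int[mu]_x (maximal_function F x `^ p + `|S x|%:E `^ p))%E).
  apply: ge0_le_integral => //.
  - by move=> x _; exact: poweR_ge0.
  - apply: measurable_maximal_poweR => k; rewrite cE; by case: ifP.
  - by apply: emeasurable_funD => //; exact: measurable_maximal_poweR.
  move=> x _.
  have : (maximal_function (fun k => cond_exp mu k S) x <=
          maxe (maximal_function F x) `|S x|%:E)%E.
    apply: ge_ereal_sup => _ [k _ <-]; rewrite le_max cE; case: ifP => _.
      by rewrite maximal_function_ub.
    by rewrite lexx orbT.
  move=> /(le_poweR (maximal_function_ge0 _ _)) /le_trans; apply.
  by rewrite maxEle; case: ifP => _; [rewrite leeDr|rewrite leeDl]; rewrite ?poweR_ge0.
rewrite ge0_integralD//; last 3 first.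
- by move=> x _; exact: poweR_ge0.
- exact: measurable_maximal_poweR.
- by move=> x _; exact: poweR_ge0.
rewrite (integral_level_powR lS).
have Fle : ((avg M (fun x => `|F M x| `^ p))%:E <=
    \int[mu]_x (maximal_function F x `^ p))%E.
  rewrite -integral_level_powR; last exact: level_martingale.
  apply: ge0_le_integral => //.
  - by move=> x _; exact: poweR_ge0.
  - apply: (measurableT_comp (measurable_poweR p)); apply/measurable_EFinP.
    exact: measurableT_comp.
  - exact: measurable_maximal_poweR.
  - by move=> x _; apply: le_poweR; rewrite ?maximal_function_ub.
set I := (\int[mu]_x _)%E in Fle *.
set w := bit_width n.
(* This lets the contribution of the maximal function of F be absorbed into the term that carries
   the factor [geom_ratio p ^- w]. *)
have r1 : 1 <= geom_ratio p ^- w.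
  rewrite invf_ge1 ?exprn_gt0 ?geom_ratio_gt0// exprn_ile1 ?ltW ?geom_ratio_gt0//.
  exact: geom_ratio_lt1.
have c0 : 0 <= partial_sum_const p.
  by rewrite mulr_ge0// invr_ge0 subr_ge0 ltW// geom_ratio_lt1.
have I0 : (0 <= I)%E by apply: integral_ge0 => x _; exact: poweR_ge0.
have r0 := le_trans ler01 r1.
have cr0 := mulr_ge0 c0 r0.
rewrite mulrDl mul1r EFinD ge0_muleDl ?lee_fin//.
apply: leeD; first by rewrite -[leLHS]mul1e lee_wpmul2r// lee_fin.
apply: le_trans (lee_wpmul2l _ Fle); last by rewrite lee_fin.
by rewrite -EFinM lee_fin; exact: avg_partial_sum_le.
Qed.

Lemma hardy_norm_partial_sum_le (F : nat -> dyadic_group -> R) n :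
  martingale mu F -> (0 < n)%N ->
  (hardy_norm mu p (fun k => cond_exp mu k (partial_sum mu n F)) <=
   ((1 + partial_sum_const p) `^ p^-1 * 2 `^ ((bit_width n)%:R * (p^-1 - 1)))%:E *
   hardy_norm mu p F)%E.
Proof.
move=> martF n0; have := hardy_norm_partial_sum_powR martF n0.
set A := hardy_norm mu p _; set B := hardy_norm mu p F => h.
have A0 : (0 <= A)%E by exact: Lnorm_ge0.
have B0 : (0 <= B)%E by exact: Lnorm_ge0.
have root (a : \bar R) : (0 <= a)%E -> ((a `^ p) `^ p^-1 = a)%E.
  by move=> a0; rewrite -poweRrM divff ?gt_eqF// poweRe1.
have c0 : 0 <= partial_sum_const p.
  by rewrite mulr_ge0// invr_ge0 subr_ge0 ltW// geom_ratio_lt1.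
have r0 : 0 <= geom_ratio p ^- bit_width n.
  by rewrite invr_ge0 exprn_ge0// ltW// geom_ratio_gt0.
rewrite -(root A)//; apply: le_trans (gt0_ler_poweR _ _ _ h) _.
- by rewrite invr_ge0 ltW.
- by rewrite in_itv/= poweR_ge0 leey.
- by rewrite in_itv/= leey mule_ge0 ?poweR_ge0// lee_fin mulr_ge0// addr_ge0.
rewrite poweRM ?poweR_ge0//; last by rewrite lee_fin mulr_ge0// addr_ge0.
rewrite root// poweR_EFin powRM ?addr_ge0//.
(* The root turns 2^(d(1-p)) into 2^(d(1/p-1)). *)
suff -> : (geom_ratio p ^- bit_width n) `^ p^-1 =
    2 `^ ((bit_width n)%:R * (p^-1 - 1)) by [].
rewrite -powR_mulrn ?powR_ge0// -powR_inv1 ?powR_ge0// -!powRrM; congr powR.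
by field; rewrite gt_eqF.
Qed.

End maximal.

(** * Part (b) *)

(** Below 2^(t+1), the quotient by 2^t is the digit at t and the remainder carries the other digits,
    which gives an induction on t. *)
Lemma bit_inj_lt t i k : (i < 2 ^ t)%N -> (k < 2 ^ t)%N -> bit i =1 bit k -> i = k.
Proof.
elim: t i k => [|t IH] i k it kt h.
  by move: it kt; rewrite expn0 !ltnS !leqn0 => /eqP -> /eqP ->.
have quot n : (n < 2 ^ t.+1)%N -> (n %/ 2 ^ t)%N = bit n t.
  rewrite expnS -ltn_divLR ?expn_gt0// /bit.
  by case: (_ %/ _)%N => [|[|]].
have rem n j : bit (n %% 2 ^ t) j = (j < t)%N && bit n j.
  case: ltnP => jt; last first.
    by rewrite bit_small// (leq_trans (ltn_pmod _ _)) ?expn_gt0// leq_exp2l.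
  by rewrite [in RHS](divn_eq n (2 ^ t)) mulnC bit_low.
rewrite (divn_eq i (2 ^ t)) (divn_eq k (2 ^ t)) !quot// h; congr (_ + _)%N.
by apply: IH; rewrite ?ltn_pmod ?expn_gt0// => j; rewrite !rem h.
Qed.

(** * Martingales with prescribed Walsh coefficients *)

Section walsh_series.
Context {R : realType} (mu : probability dyadic_group R).
Hypothesis mu_haar : normalized_haar mu.
Implicit Types (x y : dyadic_group).

(** If i and k differ in digit j, flipping coordinate j negates the product, so its average is
    zero. *)
Lemma avg_walshM M i k : (i < 2 ^ M)%N -> (k < 2 ^ M)%N ->
  avg M (fun x => walsh R i x * walsh R k x) = (i == k)%:R.
Proof.
move=> iM kM; have [->|/eqP ik] := eqVneq i k.
  have -> : avg M (fun x => walsh R k x * walsh R k x) = avg M (fun=> 1).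
    apply: eq_avg => x; rewrite -expr2 /walsh -prodrXl big1// => j _.
    by rewrite exprAC /rademacher sqrr_sign expr1n.
  by rewrite /avg sumr_const card_tuple card_bool natrX mulVf// expf_neq0.
have [j bj] : exists j, bit i j != bit k j.
  apply: contrapT => /forallNP h; apply: ik; apply: (bit_inj_lt iM kM) => j.
  by apply/eqP/negPn/negP; exact: h.
have l : level M (fun x => walsh R i x * walsh R k x).
  by apply: levelM; apply: level_walsh.
suff : avg M (fun x => walsh R i x * walsh R k x) =
    - avg M (fun x => walsh R i x * walsh R k x).
  by move=> /eqP; rewrite -addr_eq0 -mulr2n mulrn_eq0 => /eqP.
rewrite -{1}(avg_add (unit_seq j) l).
rewrite -mulN1r -avgZ; apply: eq_avg => x /=.
rewrite !walsh_add !walsh_unit_seq.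
by move: bj; case: (bit i j); case: (bit k j) => //= _; ring.
Qed.

Variable a : nat -> R.

Definition walsh_sum (m : nat) (x : dyadic_group) : R := \sum_(k < m) a k * walsh R k x.

Lemma level_walsh_sum M m : (m <= 2 ^ M)%N -> level M (walsh_sum m).
Proof.
move=> mM x y xy; apply: eq_bigr => k _.
by rewrite (level_walsh (leq_trans (ltn_ord k) mM) xy).
Qed.

Lemma martingale_walsh_sum : martingale mu (fun n => walsh_sum (2 ^ n)).
Proof.
move=> n; apply/is_cond_expP => //.
  exact: integrable_level (level_walsh_sum (leqnn (2 ^ n.+1))).
apply/funext => x; rewrite (cond_exp_sum mu_haar (M := n.+1))//; last first.
  by move=> i; exact: level_walsh.
under [RHS]eq_bigr do rewrite cond_exp_walsh//.
rewrite /walsh_sum -(big_mkord xpredT (fun k => a k * walsh R k x)).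
rewrite -(big_mkord xpredT (fun k => a k * ((k < 2 ^ n)%N%:R * walsh R k x))).
have nn : (2 ^ n <= 2 ^ n.+1)%N by rewrite leq_exp2l.
rewrite (big_cat_nat _ nn)//= [X in _ = _ + X]big_nat [X in _ = _ + X]big1.
  by rewrite addr0; apply: eq_big_nat => i /andP[_ ->]; rewrite mul1r.
by move=> i /andP[ki _]; rewrite ltnNge ki mul0r mulr0.
Qed.

Lemma walsh_coef_walsh_sum k : walsh_coef mu (fun n => walsh_sum (2 ^ n)) k = a k.
Proof.
have kk : (k < 2 ^ k)%N by exact: ltn_expl.
rewrite (walsh_coef_avg mu_haar martingale_walsh_sum kk).
under eq_avg do rewrite mulr_suml.
rewrite avg_sum (bigD1 (Ordinal kk))//= big1 => [|i ik].
  under eq_avg do rewrite -mulrA.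
  by rewrite avgZ avg_walshM// eqxx mulr1 addr0.
under eq_avg do rewrite -mulrA.
rewrite avgZ avg_walshM// (_ : (_ == _) = false) ?mulr0//.
by apply/negbTE; move: ik; rewrite -val_eqE.
Qed.

Lemma partial_sum_walsh_sum m :
  partial_sum mu m (fun n => walsh_sum (2 ^ n)) = walsh_sum m.
Proof.
by apply/funext => x; apply: eq_bigr => k _; rewrite walsh_coef_walsh_sum.
Qed.

End walsh_series.

(** * Upper bound for the Hardy quasi-norm of the block series *)

Section lacunary_blocks.
Context {R : realType} (mu : probability dyadic_group R).
Hypothesis mu_haar : normalized_haar mu.
Context (p : R).
Hypotheses (p_gt0 : 0 < p) (p_lt1 : p < 1).
Variable beta : nat -> R.
Hypothesis beta_ge0 : forall j, 0 <= beta j.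

(* The coefficients of sum_j beta_j (D_(2^(j+1)) - D_(2^j)). *)
Definition block_coef (k : nat) : R := if k == 0%N then 0 else beta (high_bit k).

(** All frequencies from 2^N up to 2^(N+1), the latter excluded, have top digit N and hence the
    coefficient [beta N]. *)
Lemma walsh_sum_block N m x : (2 ^ N <= m <= 2 ^ N.+1)%N ->
  walsh_sum block_coef m x = walsh_sum block_coef (2 ^ N) x +
  beta N * (dirichlet m x - dirichlet (2 ^ N) x).
Proof.
move=> /andP[Nm mN]; rewrite /walsh_sum /dirichlet.
rewrite -!(big_mkord xpredT (fun k => block_coef k * walsh R k x)).
rewrite -!(big_mkord xpredT (fun k => walsh R k x)).
rewrite (big_cat_nat _ Nm)//= [in RHS](big_cat_nat _ Nm)//=.
congr (_ + _); rewrite addrAC subrr add0r mulr_sumr !big_nat.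
apply: eq_bigr => k /andP[Nk km]; congr (_ * _).
have k0 : (0 < k)%N by apply: leq_trans Nk; rewrite expn_gt0.
rewrite /block_coef gtn_eqF//; congr beta; apply/eqP; rewrite eqn_leq high_bit_ge// andbT.
have /andP[h _] := high_bit_bounds k0.
by rewrite -ltnS -(ltn_exp2l _ _ (isT : 1 < 2)%N) (leq_ltn_trans h)// (leq_trans km).
Qed.

(** The difference D_(2^(j+1)) - D_(2^j) has modulus 2^j on I_j(0) and vanishes elsewhere. *)
Lemma normr_walsh_sum_block n x :
  `|walsh_sum block_coef (2 ^ n) x| <= \sum_(j < n) beta j * 2 ^+ j * (near_zero j x)%:R.
Proof.
elim: n => [|n IH].
  by rewrite expn0 /walsh_sum big_ord1 /block_coef/= mul0r normr0 big_ord0.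
rewrite (walsh_sum_block (N := n)); last by rewrite leqnn leq_exp2l// leqnSn.
rewrite big_ord_recr /=.
rewrite (le_trans (ler_normD _ _))// lerD// normrM ger0_norm// -mulrA.
rewrite ler_wpM2l// !dirichlet_pow2 near_zeroS exprS.
have h : 0 <= 2 ^+ n :> R by rewrite exprn_ge0.
case: (near_zero n x); case: (x n) => /=;
  rewrite ?mulr0 ?mul1r ?mul0r ?mulr1 ?subrr ?normr0//.
  by rewrite add0r normrN ger0_norm.
by rewrite ger0_norm; lra.
Qed.

(** The summands in the hypothesis are the integrals of the functions [g j]. By subadditivity their
    series dominates the p-th power of every |F_n|, hence of the maximal function, and it is
    integrated term by term. *)
Lemma hardy_norm_walsh_sum_block (C : R) :
  (forall n, \sum_(j < n) (beta j * 2 ^+ j) `^ p / 2 ^+ j <= C) ->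
  (hardy_norm mu p (fun n => walsh_sum block_coef (2 ^ n)) `^ p <= C%:E)%E.
Proof.
move=> hC.
pose g (j : nat) (x : dyadic_group) : R := (beta j * 2 ^+ j) `^ p * (near_zero j x)%:R.
have g0 j x : 0 <= g j x by rewrite mulr_ge0 ?powR_ge0.
have lg j : level j (g j).
  move=> x y xy; congr (_ * (nat_of_bool _)%:R); apply: eq_forallb => i.
  by rewrite xy.
have mg j : measurable_fun setT (EFin \o g j).
  by apply/measurable_EFinP; exact: measurable_level (lg j).
have gsum n x : `|walsh_sum block_coef (2 ^ n) x| `^ p <= \sum_(j < n) g j x.
  have term0 j : 0 <= beta j * 2 ^+ j * (near_zero j x)%:R :> R.
    by rewrite !mulr_ge0// exprn_ge0.
  apply: (@le_trans _ _ ((\sum_(j < n) beta j * 2 ^+ j * (near_zero j x)%:R) `^ p)).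
    by rewrite ge0_ler_powR ?nnegrE ?sumr_ge0// ?normr_walsh_sum_block// ltW.
  apply: le_trans (powR_sum_le p_gt0 p_lt1 _ _) _ => //.
  apply: ler_sum => j _; rewrite /g.
  by case: (near_zero j x); rewrite ?mulr1// !mulr0 powR0// gt_eqF.
rewrite hardy_norm_powR//.
have mw n : measurable_fun setT (walsh_sum block_coef (2 ^ n)).
  exact: measurable_level (@level_walsh_sum _ block_coef _ _ (leqnn _)).
apply: (@le_trans _ _ (\int[mu]_x (\sum_(0 <= j <oo) (g j x)%:E))%E).
  apply: ge0_le_integral => //.
  - by move=> x _; exact: poweR_ge0.
  - exact: measurable_maximal_poweR.
  - apply: (@ge0_emeasurable_sum _ _ _ _ (fun j x => (g j x)%:E) xpredT) => j *;
      by [rewrite lee_fin|exact: mg].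
  move=> x _; set S := (\sum_(0 <= j <oo) _)%E.
  have S0 : (0 <= S)%E by apply: nneseries_ge0 => j _ _; rewrite lee_fin.
  (* The maximal function itself is compared with the p-th root of S, as a supremum is bounded term
     by term before the power is taken. *)
  have -> : S = ((S `^ p^-1) `^ p)%E.
    by rewrite -poweRrM mulVf ?gt_eqF// poweRe1.
  apply: le_poweR => //; first exact: maximal_function_ge0.
  apply: ge_ereal_sup => _ [n _ <-].
  have -> : (`|walsh_sum block_coef (2 ^ n) x|%:E =
      (`|walsh_sum block_coef (2 ^ n) x|%:E `^ p) `^ p^-1)%E.
    by rewrite -poweRrM mulfV ?gt_eqF// poweRe1// lee_fin.
  apply: le_poweR; rewrite ?invr_gt0 ?poweR_ge0//.
  rewrite poweR_EFin (@le_trans _ _ (\sum_(j < n) (g j x)%:E)%E)//.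
    by rewrite sumEFin lee_fin.
  rewrite -(big_mkord xpredT (fun j => (g j x)%:E)).
  by apply: nneseries_lim_ge => j _ _; rewrite lee_fin.
rewrite integral_nneseries//; last by move=> j x _; rewrite lee_fin.
apply: lime_le.
  by apply: is_cvg_nneseries => j _ _; apply: integral_ge0 => x _; rewrite lee_fin.
apply: nearW => n; rewrite big_mkord.
under eq_bigr do rewrite (integral_level mu_haar (lg _)).
rewrite sumEFin lee_fin; apply: le_trans (hC n); apply: ler_sum => j _.
by rewrite /g avgZ (avg_near_zero mu_haar).
Qed.

End lacunary_blocks.

(** * Lower bound for the weak quasi-norm of a partial sum *)

Section lower_bound.
Context {R : realType} (mu : probability dyadic_group R).
Hypothesis mu_haar : normalized_haar mu.
Context (p : R).
Hypothesis p_gt0 : 0 < p.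
Implicit Types (x y : dyadic_group).

Lemma le_weak_Lp_norm (f : dyadic_group -> R) (lam c : R) : 0 < lam -> 0 <= c ->
  (c%:E <= mu [set x | (lam < `|f x|)%R])%E ->
  ((lam * c `^ p^-1)%:E <= weak_Lp_norm mu p f)%E.
Proof.
move=> lam0 c0 h; have pi0 : 0 < p^-1 by rewrite invr_gt0.
have -> : (lam * c `^ p^-1)%:E = ((lam `^ p * c)%R%:E `^ p^-1)%E.
  by rewrite poweR_EFin powRM ?powR_ge0// -powRrM divff ?gt_eqF// powRr1// ltW.
apply: le_poweR => //; first by rewrite lee_fin mulr_ge0 ?powR_ge0.
apply: le_ereal_sup_tmp; exists ((lam `^ p)%R%:E * mu [set x | (lam < `|f x|)%R])%E.
  by exists lam.
by rewrite EFinM lee_wpmul2l// lee_fin powR_ge0.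
Qed.

Variable beta : nat -> R.

(** The part of the sum below 2^N has rank N and cancels in the difference; D_(2^N) vanishes off
    I_N(0), and D_m changes sign under the flip. *)
Lemma walsh_sum_flip m (N := high_bit m) x : (0 < m)%N -> ~~ near_zero N x ->
  walsh_sum (block_coef beta) m x
    - walsh_sum (block_coef beta) m (dyadic_add x (unit_seq N))
  = 2 * (beta N * dirichlet m x).
Proof.
move=> m0 zx; have /andP[h1 /ltnW h2] := high_bit_bounds m0; rewrite -/N in h1 h2.
have D0 y : ~~ near_zero N y -> dirichlet (2 ^ N) y = 0 :> R.
  by move=> /negbTE zy; rewrite dirichlet_pow2 zy mul0r.
have xe : dyadic_interval N x (dyadic_add x (unit_seq N)).
  by move=> k kN; rewrite /dyadic_add /unit_seq (ltn_eqF kN) addbF.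
have zxe : ~~ near_zero N (dyadic_add x (unit_seq N)).
  apply: contra zx => /forallP h; apply/forallP => j.
  by rewrite -(xe j (ltn_ord j)); exact: h.
have mN : (2 ^ N <= m <= 2 ^ N.+1)%N by rewrite h1 h2.
rewrite !(walsh_sum_block beta _ mN) !D0// !subr0 (dirichlet_flip mN zx).
rewrite (level_walsh_sum _ (leqnn _) xe); ring.
Qed.

Lemma weak_Lp_norm_walsh_sum_ge m (Phi : R) : (0 < m)%N -> 0 < Phi ->
  (low_bit m < high_bit m)%N -> 0 < beta (high_bit m) ->
  ((beta (high_bit m) * 2 ^+ low_bit m / Phi / 2 * (2 ^- (low_bit m).+2) `^ p^-1)%R%:E <=
   weak_Lp_norm mu p (fun x => (walsh_sum (block_coef beta) m x / Phi)%R))%E.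
Proof.
move=> m0 Phi0 sN bN; set N := high_bit m in sN bN *; set s := low_bit m in sN *.
set f := fun x => _ / Phi; pose T := beta N * 2 ^+ s / Phi.
have T0 : 0 < T by rewrite divr_gt0// mulr_gt0// exprn_gt0.
have [q oq mq] := low_bitP m0; rewrite -/s in mq.
rewrite -/T; apply: le_weak_Lp_norm; first by rewrite divr_gt0.
  by rewrite invr_ge0 exprn_ge0.
set A := [set x | _].
have lf : level m f.
  move=> x y xy; rewrite /f (level_walsh_sum (block_coef beta) _ xy)//.
  by rewrite ltnW// ltn_expl.
have mA : measurable A.
  apply: (@zeta_measurable m); apply/zetaP => x Ax y xy.
  by rewrite /A /= (lf x y xy).
pose eN := unit_seq N.
have muA : mu (dyadic_add eN @` A) = mu A by exact: mu_haar.
have mA' : measurable (dyadic_add eN @` A).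
  rewrite image_dyadic_add; apply: (@zeta_measurable m); apply/zetaP => x Ax y xy.
  by have /= := level_add eN lf xy; rewrite /A /= => ->.
(* The interval on the left is the shell I_s(0) \ I_(s+1)(0). There the values of f at x and at its
   flip differ by 2T in modulus, so one of them exceeds T / 2. *)
have sub : dyadic_interval s.+1 (unit_seq s) `<=` A `|` (dyadic_add eN @` A).
  move=> x xs.
  have xss : x s by rewrite xs// /unit_seq eqxx.
  have zs : near_zero s x.
    apply/forallP => j; rewrite xs; last by rewrite ltnW// ltnS.
    by rewrite /unit_seq (ltn_eqF (ltn_ord j)).
  have zN : ~~ near_zero N x.
    by apply/forallP => /(_ (Ordinal sN)); rewrite /= xss.
  have Dm : `|dirichlet m x : R| = 2 ^+ s.
    by rewrite mq normr_dirichlet_on.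
  have diff : `|f x - f (dyadic_add x eN)| = 2 * T.
    rewrite /f -mulrBl walsh_sum_flip// !normrM Dm.
    rewrite (ger0_norm (ltW bN)) [`|Phi^-1|]ger0_norm ?invr_ge0 ?ltW// ger0_norm//.
    by rewrite /T; ring.
  have [|h1] := ltP (T / 2) `|f x|; first by left.
  have [h2|h2] := ltP (T / 2) `|f (dyadic_add x eN)|.
    right; rewrite image_dyadic_add /= /A /=.
    by rewrite dyadic_addC.
  have := ler_normB (f x) (f (dyadic_add x eN)); rewrite diff => h3.
  by exfalso; lra.
(* The flip preserves the measure, so A has at least half the measure 2^(-(s+1)) of the shell; hence
   the exponent s + 2. *)
have : (mu (dyadic_interval s.+1 (unit_seq s)) <= mu A + mu A)%E.
  rewrite -{2}muA; apply: le_trans (measureU2 _ _ _) => //.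
  apply: le_measure; rewrite ?inE//; first exact: measurable_dyadic_interval.
  exact: measurableU.
have /normalized_haarP -> := mu_haar.
have : mu A \is a fin_num by exact: fin_num_measure.
move=> /fineK <-; rewrite -EFinD !lee_fin.
by move=> h; rewrite exprS invfM; lra.
Qed.

End lower_bound.

(** * Choice of the weights *)

Lemma lt_exists_of_limn_esup {R : realType} (u : nat -> R) (K : nat) (B : R) :
  limn_esup (fun k => (u k)%:E) = +oo%E -> exists2 k, (K <= k)%N & B < u k.
Proof.
move=> uoo; have : esups (fun k => (u k)%:E) K = +oo%E.
  apply/eqP; rewrite -leye_eq -uoo limn_esup_lim.
  rewrite (cvg_lim _ (@cvg_esups_inf _ _))//.
  by apply: ereal_inf_lbound; exists K.
rewrite /esups => h; have : (B%:E < ereal_sup (sdrop (fun k => (u k)%:E) K))%E.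
  by rewrite [ltRHS]h ltry.
move=> /ereal_sup_gt[_ [k Kk <-]]; rewrite lte_fin => Bk.
by exists k.
Qed.

Lemma increasing_seq_ge (m : nat -> nat) : {homo m : i j / (i < j)%N} ->
  forall k, (k <= m k)%N.
Proof.
by move=> hm; elim=> // k IH; apply: leq_ltn_trans IH (hm _ _ (ltnSn k)).
Qed.

(** The weight q^(-i) is placed at index [j i]; its p-th power is 2^(-i), so the p-th powers sum to
    at most 2. Subadditivity covers several i that share one index. *)
Lemma exists_lacunary_weights {R : realType} (p : R) (j : nat -> nat)
    (q := 2 `^ p^-1 : R) : 0 < p -> p < 1 -> (forall i, (i < j i)%N) ->
  exists b : nat -> R, [/\ forall n, 0 <= b n, forall i, q ^- i <= b (j i) &
    forall n, \sum_(l < n) b l `^ p <= 2].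
Proof.
move=> p_gt0 p_lt1 ij; have q0 : 0 < q by exact: powR_gt0.
have t0 i : 0 <= q ^- i by rewrite invr_ge0 exprn_ge0// ltW.
(* Cutting the sum at i < n loses nothing: [j i = n] forces i < n. *)
pose b n : R := \sum_(i < n) q ^- i * (j i == n)%:R.
exists b; split => [n|i|n].
- by apply: sumr_ge0 => i _; rewrite mulr_ge0.
- rewrite /b (bigD1 (Ordinal (ij i)))//= eqxx mulr1 lerDl.
  by apply: sumr_ge0 => l _; rewrite mulr_ge0.
have qp i : (q ^- i) `^ p = 2^-1 ^+ i.
  rewrite -exprVn powR_exprn ?invr_ge0 ?ltW// /q -powRN -powRrM mulNr.
  by rewrite mulVf ?gt_eqF// powR_inv1.
apply: (@le_trans _ _ (\sum_(l < n) \sum_(i < n) 2^-1 ^+ i * (j i == l)%:R)).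
  apply: ler_sum => l _.
  apply: le_trans (powR_sum_le p_gt0 p_lt1 _ _) _.
    by move=> i; rewrite mulr_ge0.
  rewrite -(big_mkord xpredT (fun i => (q ^- i * (j i == l)%:R) `^ p)).
  rewrite -(big_mkord xpredT (fun i => 2^-1 ^+ i * (j i == l)%:R)).
  (* The range i < l is enlarged to i < n, independent of l, so that the two sums can be
     exchanged. *)
  rewrite (big_cat_nat (leq0n l) (ltnW (ltn_ord l)))/=.
  rewrite -[leLHS]addr0 lerD//; last first.
    by apply: sumr_ge0 => i _; rewrite mulr_ge0// exprn_ge0.
  apply: ler_sum => i _.
  by case: (j i == l); rewrite ?mulr1 ?qp// !mulr0 powR0// gt_eqF.
rewrite exchange_big /=; apply: (@le_trans _ _ (\sum_(i < n) 2^-1 ^+ i)).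
  apply: ler_sum => i _; rewrite -mulr_sumr -[leRHS]mulr1 ler_wpM2l ?exprn_ge0//.
  have [h|h] := ltnP (j i) n.
    rewrite (bigD1 (Ordinal h))//= eqxx big1 ?addr0// => l.
    by rewrite -val_eqE eq_sym /= => /negbTE ->.
  rewrite big1// => l _; rewrite (_ : (_ == _) = false)//.
  by apply/negbTE; rewrite neq_ltn (leq_trans (ltn_ord l) h) orbT.
rewrite -(big_mkord xpredT (fun i => 2^-1 ^+ i : R)).
have : 0 <= (2^-1 : R) < 1 by apply/andP; split; lra.
move=> /(sum_geometric_le 0 n) /le_trans; apply.
have -> : 1 - 2^-1 = 2^-1 :> R by lra.
by rewrite expr0 invrK mul1r.
Qed.

Lemma block_weight_powR {R : realType} (p b : R) l : 0 < p -> 0 <= b ->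
  (b * 2 `^ (l%:R * (p^-1 - 1)) * 2 ^+ l) `^ p / 2 ^+ l = b `^ p.
Proof.
move=> p_gt0 b0.
have -> : b * 2 `^ (l%:R * (p^-1 - 1)) * 2 ^+ l = b * 2 `^ (l%:R / p).
  rewrite -mulrA -powR_mulrn// -powRD ?pnatr_eq0 ?implybT//.
  by congr (_ * _ `^ _); ring.
rewrite powRM ?powR_ge0// -powRrM mulfVK ?gt_eqF// powR_mulrn//.
by rewrite mulfK// expf_neq0.
Qed.

(* With beta_N = b 2^(N(1/p-1)), the left-hand side is the lower bound of
   weak_Lp_norm_walsh_sum_ge. *)
Lemma weak_weightE {R : realType} (p b Phi : R) s N : 0 < p -> (s <= N)%N ->
  b * 2 `^ (N%:R * (p^-1 - 1)) * 2 ^+ s / Phi / 2 * (2 ^- s.+2) `^ p^-1 =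
  2^-1 * (2 ^- 2) `^ p^-1 * (b * (2 `^ ((N - s)%:R * (p^-1 - 1)) / Phi)).
Proof.
move=> p_gt0 sN.
have -> : (2 ^- s.+2) `^ p^-1 = (2 ^- 2) `^ p^-1 * 2 `^ (- (s%:R / p)) :> R.
  rewrite -(addn2 s) exprD invfM powRM ?invr_ge0 ?exprn_ge0//.
  rewrite [LHS]mulrC; congr (_ * _).
  by rewrite -mulNr powRrM powRN powR_mulrn.
have -> : 2 `^ ((N - s)%:R * (p^-1 - 1)) =
    2 `^ (N%:R * (p^-1 - 1)) * 2 ^+ s * 2 `^ (- (s%:R / p)) :> R.
  rewrite -powR_mulrn// -!powRD ?pnatr_eq0 ?implybT//; congr powR.
  by rewrite natrB//; ring.
by ring.
Qed.

Theorem theorem1 (R : realType) (mu : probability dyadic_group R)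
    (mu_haar : normalized_haar mu) (p : R) (p_gt0 : 0 < p) (p_lt1 : p < 1) :
  (exists c : R, forall F : nat -> dyadic_group -> R, hardy_space mu p F ->
     forall n : nat, (0 < n)%N ->
       (hardy_norm mu p (fun k => cond_exp mu k (partial_sum mu n F)) <=
        (c * 2 `^ ((bit_width n)%:R * (p^-1 - 1)))%:E * hardy_norm mu p F)%E) /\
  (forall m : nat -> nat,
     {homo m : i j / (i < j)%N} ->
     (forall k, (0 < m k)%N) ->
     ereal_sup (range (fun k => ((bit_width (m k))%:R : R)%:E)) = +oo%E ->
   forall Phi : nat -> R,
     (forall n, (0 < n)%N -> 1 <= Phi n) ->
     (forall i j, (0 < i)%N -> (i <= j)%N -> Phi i <= Phi j) ->
     limn_esup (fun k =>
       (2 `^ ((bit_width (m k))%:R * (p^-1 - 1)) / Phi (m k))%:E) = +oo%E ->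
   exists F : nat -> dyadic_group -> R, hardy_space mu p F /\
     ereal_sup (range (fun k =>
       weak_Lp_norm mu p (fun x => partial_sum mu (m k) F x / Phi (m k))))
     = +oo%E).
Proof.
split.
  exists ((1 + partial_sum_const p) `^ p^-1) => F [martF _] n n0.
  exact: hardy_norm_partial_sum_le.
move=> m hm m0 _ Phi Phi1 _ limoo.
pose q : R := 2 `^ p^-1.
have q0 : 0 < q by exact: powR_gt0.
have q1 : 1 <= q.
  by rewrite /q -[leLHS](powRr0 2) ler_powR ?ler1n// invr_ge0 ltW.
pose X k : R := 2 `^ ((bit_width (m k))%:R * (p^-1 - 1)) / Phi (m k).
(* The factor q^i will cancel the weight q^(-i), and i + 1 makes the result unbounded. Taking k at
   least 2^(i+1) forces m_k >= 2^(i+1), hence a top digit beyond i. *)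
have ex_k i : exists k, (i < high_bit (m k))%N /\ i.+1%:R * q ^+ i < X k.
  have [k ik Xk] := lt_exists_of_limn_esup (2 ^ i.+1) (i.+1%:R * q ^+ i) limoo.
  exists k; split => //; apply: high_bit_ge.
  by rewrite (leq_trans ik)// increasing_seq_ge.
have [k kP] := choice ex_k.
have [b [b_ge0 b_ge sum_b]] :=
  exists_lacunary_weights p_gt0 p_lt1 (fun i => proj1 (kP i)).
pose beta n := b n * 2 `^ (n%:R * (p^-1 - 1)).
have beta_ge0 n : 0 <= beta n by rewrite mulr_ge0 ?powR_ge0.
exists (fun n => walsh_sum (block_coef beta) (2 ^ n)%N); split.
  split; first exact: martingale_walsh_sum.
  apply: (@lty_poweRy _ _ p); first by rewrite gt_eqF.
  apply: (@le_lt_trans _ _ 2%:E); last exact: ltry.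
  apply: hardy_norm_walsh_sum_block => // n.
  by under eq_bigr do rewrite block_weight_powR//.
apply/eqyP => C C0.
(* The constant factor in [weak_weightE], which depends only on p. *)
pose D : R := 2^-1 * (2 ^- 2) `^ p^-1.
have D0 : 0 < D by rewrite mulr_gt0// powR_gt0// invr_gt0 exprn_gt0.
have [i Ci] : exists i, C <= D * i.+1%:R.
  by exists (Num.truncn (C / D)); rewrite mulrC -ler_pdivrMr// ltW// truncnS_gt.
have [_ Xi] := kP i.
have Phi0 : 0 < Phi (m (k i)) by rewrite (lt_le_trans ltr01)// Phi1.
(* Equality would give d(m) = 0 and X <= 1, against X > (i + 1) q^i >= 1. *)
have sN : (low_bit (m (k i)) < high_bit (m (k i)))%N.
  rewrite ltn_neqAle low_bit_le_high ?m0// andbT; apply/eqP => sN.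
  have : X (k i) <= 1.
    rewrite /X /bit_width sN subnn mul0r powRr0 ler_pdivrMr// mul1r.
    by apply: Phi1; exact: m0.
  apply/negP; rewrite -ltNge (le_lt_trans _ Xi)// -[leLHS]mulr1.
  by rewrite ler_pM// ?ler1n// exprn_ege1.
have bpos : 0 < b (high_bit (m (k i))).
  by rewrite (lt_le_trans _ (b_ge i))// invr_gt0 exprn_gt0.
have betapos : 0 < beta (high_bit (m (k i))) by rewrite mulr_gt0// powR_gt0.
apply: le_ereal_sup_tmp; eexists; first by exists (k i).
rewrite partial_sum_walsh_sum//.
apply: le_trans (weak_Lp_norm_walsh_sum_ge mu_haar p_gt0 (m0 _) Phi0 sN betapos).
rewrite weak_weightE//; last exact: ltnW.
rewrite lee_fin (le_trans Ci)// -/D ler_wpM2l ?(ltW D0)//.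
have : q ^- i * (i.+1%:R * q ^+ i) <= b (high_bit (m (k i))) * X (k i).
  by rewrite ler_pM ?b_ge ?invr_ge0 ?mulr_ge0 ?exprn_ge0 ?(ltW q0)// ltW.
by rewrite mulrCA mulVf ?mulr1// expf_neq0// gt_eqF.
Qed.
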